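(* Let $f=\sum_{j=1}^m f_j\mathbf{e}_j\in M^!_{k,\chi,\rho}$ be a vector-valued weakly holomorphic modular form with Fourier expansions $f_j(\tau)=\sum_{n+\kappa_j\gg 0} a_{f,j}(n)e^{2\pi i(n+\kappa_j)\tau}$, and let $n_0\in\mathbb{N}$ be such that $f_j(\tau)=O(e^{2\pi n_0 v})$ as $v=\mathrm{Im}(\tau)\to\infty$ for every $j$. \begin{enumerate} \item For $s\in\mathbb{C}$ let $I_s(x):=(2\pi)^s x^{s-1}\frac{1}{\Gamma(s)}$ for $x>0$. If $f$ is a cusp form, then for every $s$ with $\mathrm{Re}(s)>0$ for which the series $L(f,s)=\sum_{j=1}^m\sum_{n+\kappa_j>0}\frac{a_{f,j}(n)}{(n+\kappa_j)^s}\mathbf{e}_j$ converges absolutely, one has $L_f(I_s)=L(f,s)$, where $L_f(I_s):=\sum_{j=1}^m\sum_{n+\kappa_j>0}a_{f,j}(n)(\mathcal{L}I_s)(2\pi(n+\kappa_j))\mathbf{e}_j$. \item For every $\varphi\in\mathcal{F}_f$, \[L_f(\varphi)=\int_0^\infty f(iy)\varphi(y)\,dy.\] \item For every $\varphi$ such that both $\varphi$ and $\varphi|_{2-k,\chi^{-1}}S$ lie in $\mathcal{F}_f$, \[L_f(\varphi)=i^k\rho(S)\,L_f(\varphi|_{2-k,\chi^{-1}}S),\] where $(\varphi|_{2-k,\chi^{-1}}S)(x):=x^{k-2}\chi(S)\varphi(1/x)$ for $x>0$. \end{enumerate}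
   Context: Let $\Gamma=\mathrm{SL}_2(\mathbb{Z})$, $T=\left(\begin{smallmatrix}1&1\\0&1\end{smallmatrix}\right)$, $S=\left(\begin{smallmatrix}0&-1\\1&0\end{smallmatrix}\right)$. Let $k\in\frac12\mathbb{Z}$ and let $\chi:\Gamma\to\mathbb{C}$ be a unitary multiplier system of weight $k$: $|\chi(\gamma)|=1$ for all $\gamma$, and $\chi(\gamma_3)(c_3\tau+d_3)^k=\chi(\gamma_1)\chi(\gamma_2)(c_1\gamma_2\tau+d_1)^k(c_2\tau+d_2)^k$ whenever $\gamma_3=\gamma_1\gamma_2$, $\gamma_i=\left(\begin{smallmatrix}a_i&b_i\\c_i&d_i\end{smallmatrix}\right)$. Let $m\ge1$ and $\rho:\Gamma\to\mathrm{GL}(m,\mathbb{C})$ a unitary representation; $\mathbf{e}_1,\dots,\mathbf{e}_m$ is the standard basis of $\mathbb{C}^m$. For $f=\sum_j f_j\mathbf{e}_j:\mathbb{H}\to\mathbb{C}^m$ and $\gamma=\left(\begin{smallmatrix}a&b\\c&d\end{smallmatrix}\right)\in\Gamma$, $(f|_{k,\chi,\rho}\gamma)(\tau):=(c\tau+d)^{-k}\chi(\gamma)^{-1}\rho(\gamma)^{-1}f(\gamma\tau)$. Fix real numbers $\kappa_1,\dots,\kappa_m\in[0,1)$. $M^!_{k,\chi,\rho}$ is the space of holomorphic $f=\sum_j f_j\mathbf{e}_j$ on $\mathbb{H}$ with $f|_{k,\chi,\rho}\gamma=f$ for all $\gamma\in\Gamma$ and each $f_j(\tau)=\sum_{n\in\mathbb{Z},\,n+\kappa_j\gg0}a_{f,j}(n)e^{2\pi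 i(n+\kappa_j)\tau}$ (only finitely many nonzero terms with $n+\kappa_j<0$). Such $f$ is a cusp form if $a_{f,j}(n)=0$ whenever $n+\kappa_j\le 0$. $\mathcal{L}$ denotes the Laplace transform $(\mathcal{L}\varphi)(s)=\int_0^\infty e^{-st}\varphi(t)\,dt$. $\mathcal{F}_f$ is the space of functions $\varphi:\mathbb{R}_+\to\mathbb{C}$ such that (i) $(\mathcal{L}\varphi)(s)$ converges for all $s$ with $\mathrm{Re}(s)\ge-2\pi n_0$, and (ii) for each $j$ the series $\sum_{n}|a_{f,j}(n)|(\mathcal{L}|\varphi|)(2\pi(n+\kappa_j))$ converges. For $\varphi\in\mathcal{F}_f$, $L_f(\varphi):=\sum_{j=1}^m\sum_{n}a_{f,j}(n)(\mathcal{L}\varphi)(2\pi(n+\kappa_j))\mathbf{e}_j$. *)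

(* Defs.v *)
From HB Require Import structures.
From mathcomp Require Export all_boot all_order all_algebra.
From mathcomp Require Export spectral.
From mathcomp Require Export all_classical all_reals all_analysis.

Set Implicit Arguments.
Unset Strict Implicit.
Unset Printing Implicit Defensive.

Export Order.TTheory GRing.Theory Num.Theory.
Export numFieldNormedType.Exports.
(* Last, so that Re and Im are the R-valued projections of R[i]. *)
From mathcomp Require Export complex.
Export ComplexField.Normc.

#[global] Open Scope classical_set_scope.
#[global] Open Scope ring_scope.
#[global] Open Scope complex_scope.

(* Limits and derivatives of complex functions are taken in R[i]^o, the field
   R[i] with the topology of its modulus, as a normed space over itself. *)

Section ComplexFunctions.
Context {R : realType}.
Implicit Types (z s : R[i]) (x : R).

Definition cexp z : R[i] :=
  (expR (Re z) * cos (Im z)) +i* (expR (Re z) * sin (Im z)).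

(* Principal branch: -pi < Arg z <= pi for z != 0. *)
Definition Arg z : R :=
  if 0 <= Im z then acos (Re z / normc z) else - acos (Re z / normc z).

Definition Log z : R[i] := ln (normc z) +i* Arg z.

(* z ^ s for z != 0; the value at z = 0 is never used. *)
Definition cpow z s : R[i] := cexp (s * Log z).

End ComplexFunctions.

Section Series.
Context {R : realType}.

(* A series indexed by Z converges when both of its halves do. *)
Definition zsum_cvg (u : int -> R[i]) : Prop :=
  cvgn (series (fun n => u (Posz n) : R[i]^o)) /\
  cvgn (series (fun n => u (Negz n) : R[i]^o)).

Definition zsum (u : int -> R[i]) : R[i] :=
  limn (series (fun n => u (Posz n) : R[i]^o)) +
  limn (series (fun n => u (Negz n) : R[i]^o)).

Definition zsum_abs_cvg (u : int -> R[i]) : Prop :=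
  (\esum_(n in [set: int]) (normc (u n))%:E < +oo)%E.

End Series.

Section Integrals.
Context {R : realType}.
Notation mu := (@lebesgue_measure R).
Implicit Types (A : set R) (g : R -> R[i]).

Definition cintegrable A g : Prop :=
  mu.-integrable A (fun x => (Re (g x))%:E) /\
  mu.-integrable A (fun x => (Im (g x))%:E).

Definition cintegral A g : R[i] :=
  (\int[mu]_(x in A) Re (g x))%R +i* (\int[mu]_(x in A) Im (g x))%R.

(* The integral over ]0, +oo[ is improper at both ends (conditional convergence
   is allowed); it is the Lebesgue integral whenever the latter exists. *)
Definition trunc_integral g (p : R * R) : R[i]^o := cintegral `[p.1, p.2] g.

Definition improper_cvg g : Prop :=
  (forall x y : R, 0 < x -> x <= y -> cintegrable `[x, y] g) /\
  cvg (trunc_integral g @ filter_prod 0^'+ (+oo_R)).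

Definition improper_integral g : R[i] :=
  lim (trunc_integral g @ filter_prod 0^'+ (+oo_R)).

Definition laplace_cvg (phi : R -> R[i]) (s : R[i]) : Prop :=
  improper_cvg (fun t => cexp (- s * t%:C) * phi t).

Definition laplace (phi : R -> R[i]) (s : R[i]) : R[i] :=
  improper_integral (fun t => cexp (- s * t%:C) * phi t).

(* Laplace transform of |phi| at a real point, possibly +oo. *)
Definition laplace_abs (phi : R -> R[i]) (x : R) : \bar R :=
  (\int[mu]_(t in `]0%R, +oo[) (expR (- x * t) * normc (phi t))%:E)%E.

Definition euler_gamma (s : R[i]) : R[i] :=
  improper_integral (fun t => cexp (- t%:C) * cpow t%:C (s - 1)).

(* The entire function 1 / Gamma: Euler's integral for 0 < Re s, continued by
   1 / Gamma(s) = s (s + 1) ... (s + N - 1) / Gamma(s + N). *)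
Definition inv_gamma (s : R[i]) : R[i] :=
  let N := if 0 < Re s then 0%N else (Num.truncn (- Re s)).+1 in
  \prod_(i < N) (s + i%:R) / euler_gamma (s + N%:R).

Definition I_test (s : R[i]) (x : R) : R[i] :=
  cpow (2 * pi)%:C s * cpow x%:C (s - 1) * inv_gamma s.

End Integrals.

Definition SL2Z : {pred 'M[int]_2} := fun g => \det g == 1.

Definition S_mx : 'M[int]_2 := delta_mx 1 0 - delta_mx 0 1.

(* Maps on SL_2(Z) are represented by functions on 'M[int]_2, and functions on
   the upper half-plane by functions on R[i]; only the values on SL2Z, resp. at
   points with positive imaginary part, are relevant. *)

Section ModularForms.
Context {R : realType}.
Notation C := R[i].
Implicit Types (g : 'M[int]_2) (tau : C) (k : R) (chi : 'M[int]_2 -> C).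

Definition autj g tau : C := (g 1 0)%:~R * tau + (g 1 1)%:~R.

Definition moebius g tau : C :=
  ((g 0 0)%:~R * tau + (g 0 1)%:~R) / autj g tau.

Definition multiplier_system k chi : Prop :=
  (forall g, g \in SL2Z -> `|chi g| = 1) /\
  (forall g1 g2 tau, g1 \in SL2Z -> g2 \in SL2Z -> 0 < Im tau ->
    chi (g1 *m g2) * cpow (autj (g1 *m g2) tau) k%:C =
    chi g1 * chi g2 * cpow (autj g1 (moebius g2 tau)) k%:C
      * cpow (autj g2 tau) k%:C).

Variable m : nat.
Implicit Types (rho : 'M[int]_2 -> 'M[C]_m) (f : C -> 'cV[C]_m).
Implicit Types (kappa : 'I_m -> R) (a : 'I_m -> int -> C).

Definition unitary_representation rho : Prop :=
  [/\ rho 1%:M = 1%:M,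
      forall g1 g2, g1 \in SL2Z -> g2 \in SL2Z ->
        rho (g1 *m g2) = rho g1 *m rho g2 &
      forall g, g \in SL2Z -> rho g \is unitarymx].

Definition slash k chi rho f g tau : 'cV[C]_m :=
  (cpow (autj g tau) (- k)%:C * (chi g)^-1)
    *: (invmx (rho g) *m f (moebius g tau)).

Definition holomorphic_on_H f : Prop :=
  forall (j : 'I_m) tau, 0 < Im tau ->
    derivable (fun z : C^o => f z j 0 : C^o) (tau : C^o) 1.

Definition freq kappa (j : 'I_m) (n : int) : R := n%:~R + kappa j.

Definition fourier_expansion kappa f a : Prop :=
  forall j,
    finite_set [set n : int | a j n != 0 /\ freq kappa j n < 0] /\
    (forall tau, 0 < Im tau ->
      let u n := a j n * cexp (2 * pi%:C * 'i * (freq kappa j n)%:C * tau) in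
      zsum_cvg u /\ f tau j 0 = zsum u).

Definition weakly_holomorphic k chi rho kappa f : Prop :=
  [/\ holomorphic_on_H f,
      forall g tau, g \in SL2Z -> 0 < Im tau ->
        slash k chi rho f g tau = f tau &
      exists a, fourier_expansion kappa f a].

Definition cuspidal kappa a : Prop :=
  forall j n, freq kappa j n <= 0 -> a j n = 0.

(* f_j(tau) = O(exp(2 pi n0 v)) as v = Im tau -> +oo, uniformly in Re tau. *)
Definition growth_bound (n0 : nat) f : Prop :=
  forall j, exists M : R, \forall v \near +oo_R, forall u : R,
    normc (f (u +i* v) j 0) <= M * expR (2 * pi * n0%:R * v).

Definition test_space (n0 : nat) kappa a (phi : R -> C) : Prop :=
  (forall s : C, - (2 * pi * n0%:R) <= Re s -> laplace_cvg phi s) /\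
  (forall j, (\esum_(n in [set: int])
     ((normc (a j n))%:E * laplace_abs phi (2 * pi * freq kappa j n)) < +oo)%E).

Definition L_test kappa a (phi : R -> C) : 'cV[C]_m :=
  \col_j zsum (fun n => a j n * laplace phi (2 * pi * freq kappa j n)%:C).

(* The j-th component of L_f(phi) restricted to the n with n + kappa_j > 0. *)
Definition L_pos_term kappa a (phi : R -> C) (j : 'I_m) (n : int) : C :=
  if 0 < freq kappa j n
  then a j n * laplace phi (2 * pi * freq kappa j n)%:C else 0.

Definition L_pos kappa a (phi : R -> C) : 'cV[C]_m :=
  \col_j zsum (L_pos_term kappa a phi j).

Definition dirichlet_term kappa a (s : C) (j : 'I_m) (n : int) : C :=
  if 0 < freq kappa j n then a j n / cpow (freq kappa j n)%:C s else 0.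

Definition dirichlet_L kappa a (s : C) : 'cV[C]_m :=
  \col_j zsum (dirichlet_term kappa a s j).

(* (phi |_{2-k, chi^-1} S)(x) *)
Definition slash_S k chi (phi : R -> C) (x : R) : C :=
  (x `^ (k - 2))%:C * chi S_mx * phi x^-1.

Definition vimproper_cvg (F : R -> 'cV[C]_m) : Prop :=
  forall j, improper_cvg (fun y => F y j 0).

Definition vimproper_integral (F : R -> 'cV[C]_m) : 'cV[C]_m :=
  \col_j improper_integral (fun y => F y j 0).

End ModularForms.

(* Main.v *)
From HB Require Import structures.
Require Import Defs.
From mathcomp Require Import measurable_realfun ring lra.

Set Implicit Arguments.
Unset Strict Implicit.
Unset Printing Implicit Defensive.

(** Absolute convergence lets Fubini exchange the Fourier series of [f (i y)]
    with the integral against [phi], which turns [L_f(phi)] into the integral of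
    [phi y * f (i y)] over the positive half-line; the functional equation is
    then the substitution [y |-> 1/y] combined with the modularity of [f] under
    [S].  Since [phi] is merely measurable, the substitution is obtained from the
    uniqueness of Lebesgue measure rather than from the fundamental theorem of
    calculus.

    For the Dirichlet series, a rescaling reduces the Laplace transform of
    [x^(s-1)] to Euler's integral, so what is needed is [Gamma(s) <> 0] for
    [0 < Re s].  By the recurrence a zero [s] would propagate to all [s + n].
    But for [z = x + i t] with [x] large, [e^-y y^(x-1)] concentrates around
    [y = x]: bounding [cos u >= 1 - u^2/2] and [(ln u)^2 <= 4 (u - 2 + 1/u)],
    [Re (x^(-i t) Gamma(z)) >= Gamma(x) (1 - 2 t^2 / (x - 1)) > 0]. *)

(** * Complex convergence through real and imaginary parts *)

Section ComplexConvergence.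
Context {R : realType}.
Implicit Types z : R[i].
Lemma normcE_sqrt z : normc z = Num.sqrt (Re z ^+ 2 + Im z ^+ 2).
Proof. by case: z. Qed.

Lemma normc_ge0 z : 0 <= normc z.
Proof. by rewrite normcE_sqrt sqrtr_ge0. Qed.

Lemma normc_ge_normRe z : `|Re z| <= normc z.
Proof. by rewrite normcE_sqrt -sqrtr_sqr ler_wsqrtr// lerDl sqr_ge0. Qed.

Lemma normc_ge_normIm z : `|Im z| <= normc z.
Proof. by rewrite normcE_sqrt -sqrtr_sqr ler_wsqrtr// lerDr sqr_ge0. Qed.

Lemma normc_le_norm2 z : normc z <= `|Re z| + `|Im z|.
Proof.
rewrite normcE_sqrt -[leRHS]ger0_norm ?addr_ge0// -sqrtr_sqr.
rewrite ler_wsqrtr// sqrrD !real_normK ?num_real// -addrA lerD2l lerDr.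
by rewrite mulrn_wge0 ?mulr_ge0.
Qed.

Lemma ReD z1 z2 : Re (z1 + z2) = Re z1 + Re z2. Proof. by case: z1; case: z2. Qed.
Lemma ImD z1 z2 : Im (z1 + z2) = Im z1 + Im z2. Proof. by case: z1; case: z2. Qed.
Lemma ReN z : Re (- z) = - Re z. Proof. by case: z. Qed.
Lemma ImN z : Im (- z) = - Im z. Proof. by case: z. Qed.

(** The bounds [|Re z|, |Im z| <= normc z <= |Re z| + |Im z|] make the two notions agree; real
    convergence theorems then transfer to [R[i]^o]. *)
Lemma cvg_complexP {T : Type} (F : set_system T) {FF : Filter F}
    (u : T -> R[i]) (z : R[i]) :
  ((u t : R[i]^o) @[t --> F] --> (z : R[i]^o)) <->
  (Re (u t) @[t --> F] --> Re z /\ Im (u t) @[t --> F] --> Im z).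
Proof.
split => [h|[hr hi]].
- have h' (e : R) : 0 < e -> \forall t \near F, normc (z - u t) < e.
    move=> e0; move/cvgrPdist_lt : h => /(_ e%:C).
    rewrite ltcR => /(_ e0); apply: filterS => t.
    by rewrite normc_def ltcR -normcE_sqrt.
  split; apply/cvgrPdist_lt => e e0; apply: filterS (h' _ e0) => t.
  + by apply: le_lt_trans; rewrite -ReN -ReD normc_ge_normRe.
  + by apply: le_lt_trans; rewrite -ImN -ImD normc_ge_normIm.
(* The order of [R[i]] only compares numbers with equal imaginary parts, so [0 < e] makes [e] real,
   and half of it is allotted to each coordinate. *)
- apply/cvgrPdist_lt => e; rewrite ltcE/= => /andP[/eqP ie re].
  have re2 : 0 < Re e / 2 by rewrite divr_gt0.
  move/cvgrPdist_lt : hr => /(_ _ re2) hr.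
  move/cvgrPdist_lt : hi => /(_ _ re2) hi.
  apply: filterS2 hr hi => t ht1 ht2.
  rewrite normc_def -normcE_sqrt ltcE/= ie eqxx/=.
  apply: le_lt_trans (normc_le_norm2 _) _.
  by rewrite ReD ImD ReN ImN (splitr (Re e)) ltrD.
Qed.
End ComplexConvergence.

(** * Improper integrals *)

Section ImproperIntegral.
Context {R : realType}.
Notation mu := (@lebesgue_measure R).
Notation D := (`]0%R, +oo[%classic : set R).
Implicit Types g : R -> R.

(** A compact exhaustion of the open half-line, which reduces two-ended limits to a monotone
    sequence of sets. *)
Definition posseg (n : nat) : set R := `[n.+1%:R^-1, n.+1%:R].

Lemma nondecreasing_posseg : {homo posseg : n m / (n <= m)%N >-> (n <= m)%O}.
Proof.
move=> n m nm; apply/subsetPset => x; rewrite /posseg /= !in_itv/= => /andP[h1 h2].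
rewrite (le_trans _ h1) ?(le_trans h2) ?ler_nat//.
by rewrite lef_pV2 ?posrE// ler_nat.
Qed.

Lemma bigcup_posseg : \bigcup_n posseg n = D.
Proof.
apply/seteqP; split => [x [n _]|x]; rewrite /posseg /= !in_itv/=.
  by move=> /andP[h _]; rewrite andbT (lt_le_trans _ h)// invr_gt0.
rewrite andbT => x0; exists (maxn (Num.truncn x) (Num.truncn x^-1)) => //=.
rewrite in_itv/=; apply/andP; split.
- rewrite -[leRHS]invrK lef_pV2 ?posrE ?invr_gt0//.
  by rewrite (le_trans (ltW (truncnS_gt _)))// ler_nat ltnS leq_maxr.
- by rewrite (le_trans (ltW (truncnS_gt _)))// ler_nat ltnS leq_maxl.
Qed.

Lemma seg_sub_pos (x y : R) : 0 < x -> `[x, y]%classic `<=` D.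
Proof.
move=> x0 z/=; rewrite !in_itv/= andbT => /andP[h _]; exact: lt_le_trans x0 h.
Qed.

(** The truncation error is an integral over the complement of [[x, y]], bounded by the tail of
    [|g|] outside some [posseg N]; that tail is small by monotone convergence. The two endpoints may
    thus move independently, as the product filter demands. *)
Lemma cvg_trunc_Rintegral g : mu.-integrable D (EFin \o g) ->
  (\int[mu]_(x in `[p.1, p.2]) g x)%R @[p --> filter_prod 0^'+ +oo_R]
    --> (\int[mu]_(x in D) g x)%R.
Proof.
move=> ig; pose h t := `|g t|.
have ih : mu.-integrable D (EFin \o h) := integrable_norm ig.
have mseg (x y : R) : measurable `[x, y]%classic by [].
have iS g' A : mu.-integrable D (EFin \o g') -> measurable A -> A `<=` D ->
    mu.-integrable A (EFin \o g').
  by move=> i mA AD; apply: integrableS i.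
have split_ g' x y : mu.-integrable D (EFin \o g') -> 0 < x ->
    (\int[mu]_(t in D) g' t)%R =
    (\int[mu]_(t in `[x, y]) g' t)%R + (\int[mu]_(t in D `\` `[x, y]) g' t)%R.
  move=> ig' x0.
  rewrite -Rintegral_setU ?setDUK//; last 3 first.
  - exact: measurableD.
  - exact: seg_sub_pos.
  - by rewrite disj_set2E setDIK.
  - exact: seg_sub_pos.
apply/cvgrPdist_lt => e e0.
have : (\int[mu]_(x in posseg n) (EFin \o h) x)%E @[n --> \oo]
    --> (\int[mu]_(x in D) (EFin \o h) x)%E.
  rewrite -bigcup_posseg; apply: ge0_nondecreasing_set_cvg_integral.
  - exact: nondecreasing_posseg.
  - by move=> i; exact: mseg.
  - move=> i; apply: measurable_funS (measurable_int _ ih) => //.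
    by apply: seg_sub_pos; rewrite invr_gt0.
  - by move=> i x _; rewrite lee_fin normr_ge0.
have fD : (\int[mu]_(x in D) (EFin \o h) x)%E \is a fin_num.
  exact: integrable_fin_num.
rewrite -(fineK fD) => /fine_cvgP[_ /cvgrPdist_lt /(_ _ e0) [N _ /(_ N (leqnn N))]] /= HN.
rewrite -[X in `|X - _|]/(Rintegral mu D h) in HN.
(* Endpoints in these neighbourhoods span a segment containing [posseg N]. *)
exists (`]0, N.+1%:R^-1[%classic, `]N.+1%:R, +oo[%classic) => /=.
  split.
  - exists N.+1%:R^-1 => /=; first by rewrite invr_gt0.
    move=> x/=; rewrite sub0r normrN in_itv/= => xN x0; rewrite x0/=.
    by rewrite (le_lt_trans _ xN)// ler_norm.
  - exists N.+1%:R; split; first exact: num_real.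
    by move=> x/= Nx; rewrite in_itv/= Nx.
move=> [x y]/= []; rewrite !in_itv/= andbT => /andP[x0 xN] Ny.
rewrite (split_ _ _ y ig x0) addrAC subrr add0r.
apply: le_lt_trans HN; apply: le_trans (le_normr_Rintegral _ _) _ => //.
- exact: measurableD.
- by apply: iS => //; exact: measurableD.
rewrite (split_ _ N.+1%:R^-1 N.+1%:R ih) ?invr_gt0//.
rewrite -[fine _]/(Rintegral mu (posseg N) h) addrAC subrr add0r.
apply: le_trans (ler_norm _).
rewrite fine_le//.
- apply: integrable_fin_num => //; first exact: measurableD.
  by apply: iS => //; exact: measurableD.
- apply: integrable_fin_num => //; first exact: measurableD.
  by apply: iS => //; exact: measurableD.
- apply: ge0_subset_integral => //=.
  + exact: measurableD.
  + exact: measurableD.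
  + by apply: measurable_funS (measurable_int _ ih).
  + apply: setDS => z /=; rewrite !in_itv/= => /andP[z1 z2].
    by rewrite (le_trans (ltW xN) z1) (le_trans z2 (ltW Ny)).
Qed.

Lemma integrable_EFinZ (A : set R) (u : R) g : measurable A ->
  mu.-integrable A (EFin \o g) -> mu.-integrable A (EFin \o (fun x => u * g x)).
Proof.
move=> mA ig; suff : mu.-integrable A (fun x => u%:E * (EFin \o g) x)%E by [].
exact: integrableZl.
Qed.

Lemma integrable_EFinD (A : set R) g h : measurable A ->
  mu.-integrable A (EFin \o g) -> mu.-integrable A (EFin \o h) ->
  mu.-integrable A (EFin \o (fun x => g x + h x)).
Proof.
move=> mA ig ih; suff : mu.-integrable A ((EFin \o g) \+ (EFin \o h))%E by [].
exact: integrableD.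
Qed.

Lemma integrable_EFinB (A : set R) g h : measurable A ->
  mu.-integrable A (EFin \o g) -> mu.-integrable A (EFin \o h) ->
  mu.-integrable A (EFin \o (fun x => g x - h x)).
Proof.
move=> mA ig ih; suff : mu.-integrable A ((EFin \o g) \- (EFin \o h))%E by [].
exact: integrableB.
Qed.

Lemma cintegrableS (A B : set R) (g : R -> R[i]) : measurable A -> measurable B ->
  B `<=` A -> cintegrable A g -> cintegrable B g.
Proof.
move=> mA mB BA [h1 h2].
by split; [exact: integrableS h1|exact: integrableS h2].
Qed.

Lemma trunc_integral_cvg (g : R -> R[i]) : cintegrable D g ->
  trunc_integral g @ filter_prod 0^'+ +oo_R --> (cintegral D g : R[i]^o).
Proof.
move=> [h1 h2]; apply/cvg_complexP.
by split; exact: cvg_trunc_Rintegral.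
Qed.

Lemma cintegrable_improper_cvg (g : R -> R[i]) : cintegrable D g -> improper_cvg g.
Proof.
move=> ig; split; last by apply/cvg_ex; exists (cintegral D g); exact: trunc_integral_cvg.
by move=> x y x0 _; apply: cintegrableS ig => //; exact: seg_sub_pos.
Qed.

Lemma improper_integralE (g : R -> R[i]) : cintegrable D g ->
  improper_integral g = cintegral D g.
Proof.
move=> ig; apply: (@cvg_lim R[i]^o); last exact: trunc_integral_cvg.
exact: norm_hausdorff.
Qed.
End ImproperIntegral.

(** * Termwise integration of series *)

Section SeriesIntegral.
Context {R : realType}.
Notation mu := (@lebesgue_measure R).
Variables (D : set R) (mD : measurable D).

(** Dominated convergence for the partial sums. The dominating function is the sum of the majorants
    [h n], whose integral is the finite sum of their integrals. *)
Lemma cvg_series_Rintegral (g : nat -> R -> R) (h : nat -> R -> R) (G : R -> R) :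
  (forall n, measurable_fun D (g n)) -> (forall n, measurable_fun D (h n)) ->
  (forall n x, D x -> `|g n x| <= h n x) ->
  (\sum_(0 <= n <oo) \int[mu]_(x in D) (h n x)%:E < +oo)%E ->
  (forall x, D x -> series (fun n => g n x) @ \oo --> G x) ->
  mu.-integrable D (EFin \o G) /\
  series (fun n => \int[mu]_(x in D) g n x)%R @ \oo --> (\int[mu]_(x in D) G x)%R.
Proof.
move=> mg mh gh sh cG.
have h0 n x : D x -> 0 <= h n x by move=> /(gh n); apply: le_trans.
(* Extended values are kept, since the majorants may have an infinite sum at some points. *)
pose H (x : R) : \bar R := (\sum_(0 <= n <oo) (h n x)%:E)%E.
have mH : measurable_fun D H.
  apply: ge0_emeasurable_sum => [n x Dx _|n _]; first by rewrite lee_fin h0.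
  exact/measurable_EFinP.
have iH : mu.-integrable D H.
  apply/integrableP; split => //.
  under eq_integral => x /[!inE] Dx.
    rewrite gee0_abs; last by apply: nneseries_ge0 => n _ _; rewrite lee_fin h0.
    over.
  rewrite /H (@integral_nneseries _ _ _ mu D mD (fun n x => (h n x)%:E))//.
  - by move=> n; apply/measurable_EFinP; exact: mh.
pose S (n : nat) (x : R) : \bar R := (series (fun k => g k x) n)%:E.
have mS n : measurable_fun D (S n).
  apply/measurable_EFinP; rewrite /series/=.
  exact: measurable_sum.
have ig n : mu.-integrable D (EFin \o g n).
  apply: le_integrable iH => //; first by apply/measurable_EFinP; exact: mg.
  move=> x Dx /=; rewrite [leRHS]gee0_abs; last first.
    by apply: nneseries_ge0 => k _ _; rewrite lee_fin h0.
  apply: (@le_trans _ _ (h n x)%:E); first by rewrite lee_fin gh.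
  rewrite /H (nneseries_split 0 n.+1)//; last by move=> k _; rewrite lee_fin h0.
  rewrite add0n big_nat_recr//= addeAC leeDr//.
  by rewrite adde_ge0// ?sume_ge0 ?nneseries_ge0// => k *; rewrite lee_fin h0.
have SG x : D x -> S ^~ x @ \oo --> (G x)%:E.
  by move=> Dx; apply: cvg_EFin; [exact: nearW|exact: cG].
have mG : measurable_fun D (EFin \o G).
  by apply: (@emeasurable_fun_cvg _ _ _ _ S) => // x Dx; exact: SG.
have [] := @dominated_convergence _ _ _ mu D mD S (EFin \o G) H mS mG _ iH.
- by apply: aeW => x; exact: SG.
- apply: aeW => x n Dx; rewrite /S/=.
  rewrite (@le_trans _ _ (\sum_(0 <= k < n) (h k x)%:E)%E)//.
    rewrite sumEFin lee_fin (le_trans (ler_norm_sum _ _ _))//.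
    by apply: ler_sum => k _; exact: gh.
  apply: nneseries_lim_ge => k _ _; by rewrite lee_fin h0.
move=> iG _ cI; split => //.
have SE : (fun n => \int[mu]_(x in D) S n x)%E =
    EFin \o series (fun n => \int[mu]_(x in D) g n x)%R.
  apply/funext => n; rewrite /S /series/=.
  under eq_integral do rewrite -sumEFin.
  rewrite integral_sum//.
  rewrite -sumEFin; apply: eq_bigr => k _.
  apply/esym/fineK; apply: integrable_fin_num; [exact: mD|exact: ig].
move: cI; rewrite SE -[X in _ --> X]fineK; last first.
  by apply: integrable_fin_num; [exact: mD|exact: iG].
by move=> /fine_cvgP[].
Qed.

Definition cmeasurable (g : R -> R[i]) : Prop :=
  measurable_fun D (fun x => Re (g x)) /\ measurable_fun D (fun x => Im (g x)).

Lemma measurable_normc (g : R -> R[i]) : cmeasurable g ->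
  measurable_fun D (fun x => normc (g x)).
Proof.
move=> [r1 i1].
rewrite (_ : (fun x => _) = (fun x => Num.sqrt (Re (g x) ^+ 2 + Im (g x) ^+ 2))).
  apply: measurableT_comp => //.
    by apply: continuous_measurable_fun; exact: sqrt_continuous.
  by apply: measurable_funD; apply: measurable_funX.
by apply/funext => x; rewrite normcE_sqrt.
Qed.

(** The modulus dominates both the real and the imaginary part, so the real statement applies to
    each. *)
Lemma cvg_series_cintegral (g : nat -> R -> R[i]) (G : R -> R[i]) :
  (forall n, cmeasurable (g n)) ->
  (\sum_(0 <= n <oo) \int[mu]_(x in D) (normc (g n x))%:E < +oo)%E ->
  (forall x, D x -> series (fun n => g n x : R[i]^o) @ \oo --> (G x : R[i]^o)) ->
  cintegrable D G /\
  series (fun n => cintegral D (g n) : R[i]^o) @ \oo --> (cintegral D G : R[i]^o).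
Proof.
move=> mg sg cG.
have Rser (u : nat -> R[i]) n :
    Re (series (u : nat -> R[i]^o) n) = series (fun k => Re (u k)) n.
  by rewrite /series/=; apply: (big_morph _ ReD).
have Iser (u : nat -> R[i]) n :
    Im (series (u : nat -> R[i]^o) n) = series (fun k => Im (u k)) n.
  by rewrite /series/=; apply: (big_morph _ ImD).
have mn n := measurable_normc (mg n).
have [|ir cr] := @cvg_series_Rintegral (fun n x => Re (g n x)) (fun n x => normc (g n x))
  (fun x => Re (G x)) (fun n => (mg n).1) mn (fun n x _ => normc_ge_normRe _) sg _.
  move=> x Dx; have /cvg_complexP[+ _] := cG x Dx.
  by under eq_fun do rewrite Rser.
have [|ii ci] := @cvg_series_Rintegral (fun n x => Im (g n x)) (fun n x => normc (g n x))
  (fun x => Im (G x)) (fun n => (mg n).2) mn (fun n x _ => normc_ge_normIm _) sg _.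
  move=> x Dx; have /cvg_complexP[_ +] := cG x Dx.
  by under eq_fun do rewrite Iser.
split; first by split.
apply/cvg_complexP; split.
- by under eq_fun do rewrite Rser.
- by under eq_fun do rewrite Iser.
Qed.
End SeriesIntegral.

(** * Change of variables on the positive half-line *)

Section Substitution.
Context {R : realType}.
Notation mu := (@lebesgue_measure R).
Notation D := (`]0%R, +oo[%classic : set R).
Import HBNNSimple.
Local Open Scope ereal_scope.

Variables (F w : R -> R).
Hypothesis mF : measurable_fun D F.
Hypothesis mw : measurable_fun D w.
Hypothesis w0 : forall y, (0 < y)%R -> (0 <= w y)%R.
Hypothesis F0 : forall y, (0 < y)%R -> (0 < F y)%R.
(* The image of [w dy] under [F] has the mass of Lebesgue measure on each ]0, c];
   by uniqueness of Lebesgue measure this is enough. *)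
Hypothesis FE : forall c : R, (0 < c)%R ->
  \int[mu]_(y in D `&` F @^-1` `]0%R, c]) (w y)%:E = c%:E.

Let Dgt y : D y -> (0 < y)%R.
Proof. by rewrite /= in_itv/= andbT. Qed.

Let mD : measurable D. Proof. by []. Qed.

Let mpre (A : set R) : measurable A -> measurable (D `&` F @^-1` A).
Proof. by move=> mA; exact: mF. Qed.

(** The image under [F] of the measure with density [w] on the half-line. *)
Definition image_density (A : set (measurableTypeR R)) : \bar R :=
  \int[mu]_(y in D `&` F @^-1` A) (w y)%:E.

Let image_density0 : image_density set0 = 0.
Proof. by rewrite /image_density preimage_set0 setI0 integral_set0. Qed.

Let image_density_ge0 A : 0 <= image_density A.
Proof. by apply: integral_ge0 => y [/Dgt y0 _]; rewrite lee_fin w0. Qed.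

Let image_density_sigma_additive : semi_sigma_additive image_density.
Proof.
move=> /= A mA tA mUA; rewrite /image_density; apply: cvg_toP.
  apply: ereal_nondecreasing_is_cvgn => m n mn.
  apply: lee_sum_nneg_natr => // k _ _.
  exact: image_density_ge0.
rewrite preimage_bigcup setI_bigcupr ge0_integral_bigcup//=.
- by move=> k; exact: (mpre (mA k)).
- apply/measurable_EFinP; apply: measurable_funS mw => //.
  by move=> y [k _ []].
- by move=> y [k _ [/Dgt y0 _]]; rewrite lee_fin w0.
- apply/trivIsetP => i j _ _ ij.
  rewrite setIACA setIid -preimage_setI.
  by move/trivIsetP : tA => /(_ i j Logic.I Logic.I ij) ->; rewrite preimage_set0 setI0.
Qed.

Let nu1 : {measure set (measurableTypeR R) -> \bar R} := HB.pack image_density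
  (isMeasure.Build _ _ _ image_density image_density0 image_density_ge0
     image_density_sigma_additive).

Let nu1_oc0 (c : R) : (0 <= c)%R -> nu1 `]0%R, c]%classic = c%:E.
Proof.
rewrite le_eqVlt => /predU1P[<-|c0]; last exact: FE.
by rewrite set_itvoc0 measure0.
Qed.

Let nu1_oc (a c : R) : (0 <= a)%R -> (a <= c)%R -> nu1 `]a, c]%classic = (c - a)%:E.
Proof.
move=> a0 ac.
have -> : `]a, c]%classic = `]0%R, c]%classic `\` `]0%R, a]%classic.
  apply/seteqP; split => x/=; rewrite !in_itv/=.
    move=> /andP[ax xc]; rewrite xc (le_lt_trans a0 ax)/=; split => //.
    by rewrite leNgt ax.
  move=> [/andP[x0 xc]]; rewrite x0/= xc => /negP; rewrite -ltNge => ->//.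
rewrite measureD//= ?setIidr.
- rewrite -[image_density `]0%R, c]%classic]/(nu1 _).
  rewrite -[image_density `]0%R, a]%classic]/(nu1 _).
  by rewrite !nu1_oc0// (le_trans a0).
- by move=> x /=; rewrite !in_itv/= => /andP[-> xa]; rewrite (le_trans xa).
- by rewrite -[image_density _]/(nu1 _) nu1_oc0 ?ltry// (le_trans a0).
Qed.

(** [F] maps the half-line into itself, so the image measure is carried by it. *)
Let nu1I A : nu1 A = nu1 (A `&` D).
Proof.
rewrite /= /image_density; congr (integral _ _ _).
apply/seteqP; split => y /= [y0 Fy]; split => //.
  by split => //; rewrite in_itv/= andbT F0// (Dgt y0).
by case: Fy.
Qed.

Let mDc : measurable (~` D). Proof. exact: measurableC. Qed.

(** Uniqueness of Lebesgue measure concerns the whole line, so the image measure is completed by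
    Lebesgue measure on the nonpositive numbers. *)
Let nu : {measure set (measurableTypeR R) -> \bar R} := measure_add nu1 (mrestr mu mDc).

Let nuD A : nu A = nu1 A + mu (A `&` ~` D).
Proof. exact: measure_addE. Qed.

Let nuE A : measurable A -> mu A = nu A.
Proof.
move: A; apply: lebesgue_measure_unique => _ [[a b] _ <-].
rewrite nuD nu1I /=.
(* The interval is cut at 0; the cases below place 0 relative to its endpoints. *)
have -> : `]a, b]%classic `&` D = `]Num.max a 0%R, b]%classic.
  apply/seteqP; split => x /=; rewrite !in_itv/= gt_max andbT.
    by move=> [/andP[-> ->] ->].
  by move=> /andP[/andP[-> ->] ->].
have -> : `]a, b]%classic `&` ~` D = `]a, Num.min b 0%R]%classic.
  apply/seteqP; split => x /=; rewrite !in_itv/= le_min andbT.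
    by move=> [/andP[-> ->] /negP]; rewrite -leNgt.
  by move=> /andP[-> /andP[-> x0]]; split => //; apply/negP; rewrite -leNgt.
rewrite !lebesgue_measure_itv/= !lte_fin.
rewrite -[image_density _]/(nu1 _).
have [ab|ba] := ltP a b; last first.
  rewrite ltNge (le_trans _ ba) ?ge_min ?lexx//= adde0.
  rewrite -[image_density _]/(nu1 _).
  by rewrite set_itv_ge ?measure0// bnd_simp -leNgt le_max ba.
have [b0|b0] := leP b 0%R.
  rewrite ab set_itv_ge ?measure0 ?add0e// bnd_simp -leNgt.
  by rewrite le_max b0 orbT.
have [a0|a0] := leP 0%R a.
  by rewrite nu1_oc// 1?ltW// adde0.
by rewrite nu1_oc// ?ltW// -EFinB -!EFinD; congr EFin; ring.
Qed.

Let nu1E A : measurable A -> nu1 A = mu (A `&` D).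
Proof.
move=> mA; rewrite nuE; last exact: measurableI.
rewrite nuD -setIA setICr setI0 measure0 adde0.
exact: nu1I.
Qed.

(** A simple function is a finite combination of indicators of its level sets, and on each of them
    the claim is the equality of [nu1] with Lebesgue measure. *)
Let nnsfun_case (f : {nnsfun (measurableTypeR R) >-> R}) :
  \int[mu]_(y in D) ((f (F y))%:E * (w y)%:E) = \int[mu]_(y in D) (f y)%:E.
Proof.
have mf r : measurable (f @^-1` [set r]) by exact: measurable_funPTI.
transitivity (\sum_(r \in range f) r%:E * mu (f @^-1` [set r] `&` D)); last first.
  under [RHS]eq_integral do rewrite fimfunE -fsumEFin//.
  rewrite ge0_integral_fsum//.
  - apply: eq_fsbigr => r _; rewrite integralZl_indic_nnsfun// integral_indic//.
  - by move=> r; exact/measurable_EFinP/measurable_funM.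
  - by move=> r x _; rewrite nnfun_muleindic_ge0.
pose E r := D `&` F @^-1` (f @^-1` [set r]).
have mE r : measurable (E r) by exact: (mpre (mf r)).
have mwE r : measurable_fun D (w \_ (E r)).
  apply/(measurable_restrict w (mE r) mD).
  by rewrite /E setIA setIid; apply: measurable_funS mw.
have wE0 r y : D y -> (0 <= (w \_ (E r)) y)%R.
  by move=> /Dgt y0; rewrite patchE; case: ifPn => // _; rewrite w0.
transitivity (\sum_(r \in range f)
    \int[mu]_(y in D) (r%:E * ((w \_ (E r)) y)%:E)).
  rewrite -ge0_integral_fsum//.
  - apply: eq_integral => y /[!inE] Dy.
    rewrite fimfunE -fsumEFin// ge0_mule_fsuml; last first.
      by move=> r; rewrite nnfun_muleindic_ge0.
    apply: eq_fsbigr => r _; rewrite EFinM -muleA; congr (_ * _).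
    rewrite patchE indicE -EFinM.
    have -> : (y \in E r) = (F y \in f @^-1` [set r]).
      by apply/idP/idP; rewrite !inE => // -[].
    by case: ifPn => _; rewrite ?mul1r ?mul0r.
  - by move=> r; apply/measurable_EFinP/measurable_funM => //; exact: mwE.
  - move=> r y Dy; rewrite patchE; case: ifPn => [|_]; last by rewrite mule0.
    rewrite inE /E /preimage /= => -[_ <-].
    by rewrite mule_ge0// lee_fin// w0// Dgt.
apply: eq_fsbigr => r; rewrite inE => -[x _ <-].
rewrite ge0_integralZl_EFin//.
- rewrite -nu1E//= /image_density; congr (_ * _).
  rewrite (_ : D `&` _ = D `&` E (f x)); last by rewrite /E setIA setIid.
  by rewrite integral_mkcondr/=; apply: eq_integral => y _; rewrite !patchE; case: ifPn.
- by move=> y Dy; rewrite lee_fin wE0.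
- by apply/measurable_EFinP; exact: mwE.
Qed.

(** Simple functions increasing to [h] give the result by monotone convergence on both sides. *)
Lemma ge0_integral_substitution (h : R -> \bar R) : measurable_fun D h ->
  (forall y, D y -> 0 <= h y) ->
  \int[mu]_(y in D) (h (F y) * (w y)%:E) = \int[mu]_(y in D) h y.
Proof.
move=> mh h0.
pose f_ := @nnsfun_approx _ (measurableTypeR R) R D mD h mh.
have mf n : measurable_fun [set: measurableTypeR R] (f_ n) by exact: measurable_funPT.
have cf x : D x -> EFin \o f_ ^~ x @ \oo --> h x.
  by move=> Dx; apply: cvg_nnsfun_approx.
have ndf m n x : (m <= n)%N -> (f_ m x <= f_ n x)%R.
  by move=> mn; exact/lefP/nd_nnsfun_approx.
have FD y : D y -> D (F y) by move=> /Dgt y0; rewrite /= in_itv/= andbT F0.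
transitivity (limn (fun n => \int[mu]_(x in D) (f_ n x)%:E)); last first.
  rewrite -monotone_convergence//.
  - by apply: eq_integral => y /[!inE] yD; apply/cvg_lim => //; exact: cf.
  - by move=> n; apply/measurable_EFinP; apply: measurable_funTS; exact: mf.
  - by move=> n y _; rewrite lee_fin.
  - by move=> y _ m n mn; rewrite lee_fin; exact/lefP/nd_nnsfun_approx.
have -> : (fun n => \int[mu]_(x in D) (f_ n x)%:E) =
    (fun n => \int[mu]_(y in D) ((f_ n (F y))%:E * (w y)%:E)).
  by apply/funext => n; exact/esym/nnsfun_case.
rewrite -monotone_convergence//.
- apply: eq_integral => y /[!inE] yD; apply/esym/cvg_lim => //.
  by apply: cvgeZr => //; apply: cf; exact: FD.
- move=> n; apply/measurable_EFinP/measurable_funM => //.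
  by apply: (measurableT_comp (mf n)); exact: mF.
- by move=> n y /Dgt y0; rewrite mule_ge0// lee_fin// w0.
- move=> y /Dgt y0 m n mn; rewrite lee_wpmul2r// lee_fin ?w0//.
  exact: ndf.
Qed.

(** Positive and negative parts are substituted separately; multiplication by the nonnegative [w]
    commutes with taking them. *)
Lemma Rintegral_substitution (g : R -> R) : measurable_fun D g ->
  (\int[mu]_(y in D) (g (F y) * w y) = \int[mu]_(y in D) g y)%R.
Proof.
move=> mg; congr fine.
rewrite [LHS]integralE [RHS]integralE; congr (_ - _).
- rewrite -[RHS]ge0_integral_substitution//.
  + apply: eq_integral => y /[!inE] /Dgt y0.
    by rewrite !funeposE -!EFin_max -EFinM maxr_pMl ?w0// mul0r.
  + exact/measurable_funepos/measurable_EFinP.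
- rewrite -[RHS]ge0_integral_substitution//.
  + apply: eq_integral => y /[!inE] /Dgt y0.
    by rewrite !funenegE -!EFinN -!EFin_max -EFinM maxr_pMl ?w0// mul0r mulNr.
  + exact/measurable_funeneg/measurable_EFinP.
Qed.
End Substitution.

(** * Nonvanishing of the Gamma function *)

Section GammaKernel.
Context {R : realType}.
Notation mu := (@lebesgue_measure R).
Notation D := (`]0%R, +oo[%classic : set R).
Implicit Types (s t c x : R).

Lemma is_derive_cvg (F : R -> R) x (l : R) : is_derive x 1 F l -> {for x, continuous F}.
Proof.
by move=> dF; apply: differentiable_continuous; apply/derivable1_diffP; exact: ex_derive.
Qed.

Lemma measurable_fun_pos (f : R -> R) :
  (forall x, 0 < x -> {for x, continuous f}) -> measurable_fun D f.
Proof.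
move=> cf; apply: open_continuous_measurable_fun; first exact: interval_open.
by move=> x; rewrite inE/= in_itv/= andbT => x0; exact: cf.
Qed.

Lemma pos_FTC2 (F f : R -> R) (a b : R) : 0 < a -> a < b ->
  (forall x, 0 < x -> is_derive x 1 F (f x)) ->
  (forall x, 0 < x -> {for x, continuous f}) ->
  (\int[mu]_(x in `[a, b]) (f x)%:E = (F b)%:E - (F a)%:E)%E.
Proof.
move=> a0 ab dF cf; have b0 := lt_trans a0 ab.
apply: continuous_FTC2 => //.
- apply: continuous_in_subspaceT => x; rewrite inE/= in_itv/= => /andP[ax _].
  by apply: cf; exact: lt_le_trans ax.
- split.
  + move=> x; rewrite in_itv/= => /andP[ax _].
    by have := dF _ (lt_trans a0 ax) => ?; exact: ex_derive.
  + by apply: cvg_at_right_filter; exact: is_derive_cvg (dF _ a0).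
  + by apply: cvg_at_left_filter; exact: is_derive_cvg (dF _ b0).
- move=> x; rewrite in_itv/= => /andP[ax _].
  by rewrite derive1E; have := dF _ (lt_trans a0 ax) => ?; exact: derive_val.
Qed.

(** The fundamental theorem holds on each [[x, y]]; integrability identifies the limit of these
    integrals with the Lebesgue integral. *)
Lemma Rintegral_pos_derive (F f : R -> R) (l l' : R) :
  (forall x, 0 < x -> is_derive x 1 F (f x)) ->
  (forall x, 0 < x -> {for x, continuous f}) ->
  mu.-integrable D (EFin \o f) ->
  F x @[x --> 0^'+] --> l -> F x @[x --> +oo_R] --> l' ->
  (\int[mu]_(x in D) f x = l' - l)%R.
Proof.
move=> dF cf intf Fl Fl'; have cI := cvg_trunc_Rintegral intf.
have cF : F p.2 - F p.1 @[p --> filter_prod 0^'+ +oo_R] --> l' - l.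
  apply: cvgB.
  - by apply: cvg_comp Fl'; exact: cvg_snd.
  - by apply: cvg_comp Fl; exact: cvg_fst.
apply: (cvg_unique (@Rhausdorff R) cI).
apply: cvg_trans cF; apply: near_eq_cvg.
(* Separating the endpoints by 1 guarantees [x < y]. *)
exists (`]0, 1[%classic, `]1, +oo[%classic) => /=.
  split.
  - exists 1 => //= x/=; rewrite sub0r normrN in_itv/= => x1 x0; rewrite x0/=.
    by rewrite (le_lt_trans _ x1)// ler_norm.
  - exists 1; split; first exact: num_real.
    by move=> x/= x1; rewrite in_itv/= x1.
move=> [x y]/= []; rewrite !in_itv/= andbT => /andP[x0 x1] y1.
by rewrite /Rintegral (pos_FTC2 x0 (lt_trans x1 y1) dF cf).
Qed.

(* Phases [c = 0] and [c = - pi / 2] give the real and imaginary parts of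
   [e^-x x^(s + i t)]. *)
Definition gker s t c x : R := expR (s * ln x - x) * cos (t * ln x + c).

Lemma expR_lnB1 s x : 0 < x -> expR ((s - 1) * ln x - x) = expR (s * ln x - x) * x^-1.
Proof.
move=> x0; rewrite (_ : (s - 1) * ln x - x = s * ln x - x - ln x); last by ring.
by rewrite expRD expRN lnK.
Qed.

(** Differentiating the cosine shifts its phase by [pi / 2], and the factor [1 / x] lowers [s] by
    one, so these kernels are closed under differentiation. Integrated, the identity becomes the
    recurrence of Gamma. *)
Lemma is_derive_gker s t c x : 0 < x -> is_derive x 1 (gker s t c)
  (- gker s t c x + s * gker (s - 1) t c x + t * gker (s - 1) t (c + pi / 2) x).
Proof.
move=> x0; have dln := is_derive1_ln x0.
have d1 : is_derive x 1 (s *: @ln R - id) (s *: x^-1 - 1) by apply: is_deriveB.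
have d2 : is_derive x 1 (t *: @ln R + cst c) (t *: x^-1 + 0) by apply: is_deriveD.
have e1 := is_derive1_comp (is_derive_expR ((s *: @ln R - id) x)) d1.
have e2 := is_derive1_comp (is_derive_cos ((t *: @ln R + cst c) x)) d2.
have e3 := is_deriveM e1 e2.
set v := (X in is_derive _ _ _ X).
suff : is_derive x 1
  ((expR \o (s *: @ln R - id)) * (cos \o (t *: @ln R + cst c))) v by [].
apply: (@is_derive_eq _ _ _ _ _ _ _ _ e3).
rewrite {}/v.
rewrite -[LHS]/(expR (s * ln x - x) * (- sin (t * ln x + c) * (t * x^-1 + 0)) +
  cos (t * ln x + c) * (expR (s * ln x - x) * (s * x^-1 - 1))).
rewrite /gker addrA cosDpihalf !expR_lnB1//.
by ring.
Qed.

Lemma continuous_gker s t c x : 0 < x -> {for x, continuous (gker s t c)}.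
Proof. by move=> x0; exact: is_derive_cvg (is_derive_gker s t c x0). Qed.

(** This is [ln v <= v - 1] at [v = x / s], with a term [- s] dropped. It bounds [x^s e^-x]
    explicitly. *)
Lemma ln_le_sub s x : 0 < s -> 0 < x -> s * ln x - x <= s * ln s.
Proof.
move=> s0 x0.
have h : ln (x / s) <= x / s - 1.
  rewrite -[in leLHS](addrNK 1 (x / s)) [_ - 1 + 1]addrC le_ln1Dx//.
  by rewrite ltrBrDl subrr divr_gt0.
rewrite ln_div ?posrE// in h.
rewrite -(ler_pM2l s0) mulrBr mulrBr mulr1 mulrCA divff ?gt_eqF// mulr1 in h.
lra.
Qed.

Lemma gker_le s t c x : `|gker s t c x| <= expR (s * ln x - x).
Proof.
rewrite normrM ger0_norm ?expR_ge0// -[leRHS]mulr1 ler_wpM2l ?expR_ge0//.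
exact: cos_max.
Qed.

(* An integrable majorant of [e^-x x^(s-1)], chosen for its explicit primitive. *)
Definition gmaj s x : R := expR ((s - 1) * ln x) / (1 + expR (s * ln x)) ^+ 2.

Lemma is_derive_gmaj s x : 0 < s -> 0 < x ->
  is_derive x 1 (fun y => - (s * (1 + expR (s * ln y)))^-1) (gmaj s x).
Proof.
move=> s0 x0; have dln := is_derive1_ln x0.
have d1 : is_derive x 1 (s *: @ln R) (s *: x^-1) by apply: is_deriveZ.
have e1 := is_derive1_comp (is_derive_expR ((s *: @ln R) x)) d1.
have e2 : is_derive x 1 (cst 1 + (expR \o (s *: @ln R)))
    (0 + expR ((s *: @ln R) x) * (s *: x^-1)).
  by apply: is_deriveD.
have e3 := is_deriveZ s e2.
have h : 0 < 1 + expR (s * ln x) by rewrite addr_gt0// expR_gt0.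
have n0 : (s *: (cst 1 + (expR \o (s *: @ln R)))) x != 0.
  by rewrite -[(_ *: _) x]/(s * (1 + expR (s * ln x))) mulf_neq0 ?gt_eqF.
have e4 := is_deriveN (is_deriveV n0 e3).
set v := (X in is_derive _ _ _ X).
suff : is_derive x 1
  (- (fun y => ((s *: (cst 1 + (expR \o (s *: @ln R)))) y)^-1)) v by [].
apply: (@is_derive_eq _ _ _ _ _ _ _ _ e4); rewrite {}/v.
rewrite -[LHS]/(- (- (s * (1 + expR (s * ln x))) ^- 2 *
  (s * (0 + expR (s * ln x) * (s * x^-1))))) /gmaj.
have -> : expR ((s - 1) * ln x) = expR (s * ln x) / x.
  by rewrite mulrBl mul1r expRD expRN lnK.
by field; rewrite !gt_eqF.
Qed.

Lemma continuous_gmaj s x : 0 < s -> 0 < x -> {for x, continuous (gmaj s)}.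
Proof.
move=> s0 x0.
have cl u : {for x, continuous (fun y => expR (u * ln y))}.
  apply: (@continuous_comp _ _ _ (fun y => u * ln y) expR); last exact: continuous_expR.
  by apply: continuousM; [exact: cvg_cst|exact: continuous_ln].
have h : 0 < 1 + expR (s * ln x) by rewrite addr_gt0// expR_gt0.
apply: continuousM; first exact: cl.
apply: continuousV; first by rewrite expf_neq0// gt_eqF.
by apply: (@continuousM _ _ (fun y => 1 + expR (s * ln y)) (fun y => 1 + expR (s * ln y)));
  apply: continuousD; [exact: cvg_cst|exact: cl|exact: cvg_cst|exact: cl].
Qed.

Lemma gmaj_ge0 s x : 0 <= gmaj s x.
Proof. by rewrite divr_ge0 ?expR_ge0// exprn_ge0// addr_ge0// expR_ge0. Qed.

(** The primitive [- 1 / (s (1 + x^s))] increases from [- 1 / s] to [0], so the integrals over the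
    segments [posseg n] stay below [1 / s]. *)
Lemma integrable_gmaj s : 0 < s -> mu.-integrable D (EFin \o gmaj s).
Proof.
move=> s0.
have mg : measurable_fun D (gmaj s).
  by apply: measurable_fun_pos => x x0; exact: continuous_gmaj.
apply/integrableP; split; first exact/measurable_EFinP.
under eq_integral do rewrite /= ger0_norm ?gmaj_ge0//.
apply: (@le_lt_trans _ _ (s^-1)%:E); last exact: ltry.
have : (\int[mu]_(x in posseg n) (gmaj s x)%:E)%E @[n --> \oo]
    --> (\int[mu]_(x in D) (gmaj s x)%:E)%E.
  rewrite -bigcup_posseg; apply: ge0_nondecreasing_set_cvg_integral.
  - exact: nondecreasing_posseg.
  - by move=> i; exact: measurable_itv.
  - move=> i; apply/measurable_EFinP; apply: measurable_funS mg => //.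
    by apply: seg_sub_pos; rewrite invr_gt0.
  - by move=> i x _; rewrite lee_fin gmaj_ge0.
move=> cg; rewrite -(cvg_lim _ cg)//; apply: lime_le.
  by apply/cvg_ex; eexists; exact: cg.
near=> n.
(* [posseg 0] is a single point, while the fundamental theorem is applied with distinct
   endpoints. *)
have n1 : n.+1%:R^-1 < n.+1%:R :> R.
  have n0 : (0 < n)%N by near: n; exact: nbhs_infty_gt.
  by rewrite (@lt_trans _ _ 1)// ?invf_lt1// ltr1n.
have n0 : 0 < n.+1%:R^-1 :> R by rewrite invr_gt0.
pose Q y := - (s * (1 + expR (s * ln y)))^-1 : R.
have FE : (\int[mu]_(x in posseg n) (gmaj s x)%:E =
    (Q n.+1%:R)%:E - (Q n.+1%:R^-1)%:E)%E.
  apply: (@pos_FTC2 Q) => // x x0.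
  - exact: is_derive_gmaj.
  - exact: continuous_gmaj.
rewrite FE /Q -EFinB lee_fin opprK.
have h u : 0 < 1 + expR u by rewrite addr_gt0// expR_gt0.
apply: (@le_trans _ _ (s * (1 + expR (s * ln n.+1%:R^-1)))^-1).
  by rewrite gerDr oppr_le0 invr_ge0 mulr_ge0// ltW.
rewrite lef_pV2 ?posrE ?mulr_gt0// ler_peMr ?(ltW s0)//.
by rewrite lerDl expR_ge0.
Unshelve. all: by end_near. Qed.

(** With [e = x^(s + 1)], comparison with [gmaj (s + 1)] amounts to bounding
    [expR (- x) * (1 + e)^2]. Since [(1 + e)^2 <= 2 (1 + e^2)], only [expR (- x) * e^2] has to be
    controlled. *)
Lemma integrable_gker s t c : -1 < s -> mu.-integrable D (EFin \o gker s t c).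
Proof.
move=> s1; have s0 : 0 < s + 1 by lra.
(* The bound of [ln_le_sub] for [x^(2 (s + 1)) e^-x]. *)
pose K := expR (2 * (s + 1) * ln (2 * (s + 1))).
have iM : mu.-integrable D (fun x => (2 * (1 + K))%:E * (EFin \o gmaj (s + 1)) x)%E.
  by apply: integrableZl => //; exact: integrable_gmaj.
apply: le_integrable iM => //.
  by apply/measurable_EFinP; apply: measurable_fun_pos => x; exact: continuous_gker.
move=> x /=; rewrite in_itv/= andbT => x0; rewrite lee_fin.
apply: le_trans (gker_le _ _ _ _) _; apply: le_trans (ler_norm _).
rewrite /gmaj addrK mulrA ler_pdivlMr ?exprn_gt0 ?addr_gt0 ?expR_gt0//.
rewrite [leRHS]mulrC expRD -mulrA ler_pM2l ?expR_gt0//.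
set e := expR ((s + 1) * ln x).
apply: (@le_trans _ _ (expR (- x) * (2 * (1 + e ^+ 2)))).
  rewrite ler_wpM2l ?expR_ge0//.
  have := sqr_ge0 (e - 1); nra.
have h1 : expR (- x) <= 1 by rewrite -[leRHS]expR0 ler_expR oppr_le0 ltW.
have h2 : expR (- x) * e ^+ 2 <= K.
  rewrite /e -expRM_natl -expRD ler_expR.
  have := @ln_le_sub (2 * (s + 1)) x _ x0; rewrite mulr_gt0// => /(_ isT); lra.
lra.
Qed.

Lemma gker_cvg0 s t c : 0 < s -> gker s t c x @[x --> 0^'+] --> 0.
Proof.
move=> s0; apply/norm_cvg0P.
apply: (@squeeze_cvgr _ _ _ _ (cst 0) (fun x => x `^ s)); last 2 first.
- exact: cvg_cst.
- exact: powR_cvg0.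
near=> x; have x0 : 0 < x by near: x; exact: nbhs_right_gt.
rewrite normr_ge0/= (le_trans (gker_le _ _ _ _))// /powR gt_eqF// ler_expR.
by rewrite gerBl ltW.
Unshelve. all: by end_near. Qed.

Lemma gker_cvgy s t c : 0 < s -> gker s t c x @[x --> +oo_R] --> 0.
Proof.
move=> s0; apply/norm_cvg0P.
(* This bounds [x^(s + 1) e^-x]; the spare power of [x] yields the decay [K / x]. *)
pose K := expR ((s + 1) * ln (s + 1)).
apply: (@squeeze_cvgr _ _ _ _ (cst 0) (fun x => K * x^-1)); last 2 first.
- exact: cvg_cst.
- rewrite -[X in _ --> X](mulr0 K); apply: cvgMr.
  by apply: (gtr0_cvgV0 (f := id) _).2; [exact: nbhs_pinfty_gt|exact: cvg_id].
near=> x; have x0 : 0 < x by near: x; exact: nbhs_pinfty_gt.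
rewrite normr_ge0/= (le_trans (gker_le _ _ _ _))//.
rewrite -[s in leLHS](addrK 1) expR_lnB1// ler_pM2r ?invr_gt0// ler_expR.
by rewrite ln_le_sub// addr_gt0.
Unshelve. all: by end_near. Qed.

(** The real part of [e^(i c) Gamma(s + i t)]. *)
Definition Gm s t c : R := (\int[mu]_(x in D) gker (s - 1) t c x)%R.

(** This is [Gamma(z + 1) = z Gamma(z)] at [z = s + i t], where multiplication by [i] is a phase
    shift by [pi / 2]. It follows by integrating the derivative of [gker s t c], which tends to 0 at
    both ends. *)
Lemma Gm_rec s t c : 0 < s ->
  Gm (s + 1) t c = s * Gm s t c + t * Gm s t (c + pi / 2).
Proof.
move=> s0.
have i0 : mu.-integrable D (EFin \o gker s t c) by apply: integrable_gker; lra.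
have i1 c' : mu.-integrable D (EFin \o gker (s - 1) t c').
  by apply: integrable_gker; lra.
have i1Z u c' : mu.-integrable D (EFin \o (fun x => u * gker (s - 1) t c' x)).
  exact: integrable_EFinZ.
have iN : mu.-integrable D (EFin \o (fun x => - gker s t c x)).
  suff : mu.-integrable D (EFin \o (fun x => -1 * gker s t c x)).
    by apply: eq_integrable => // x _; rewrite /= mulN1r.
  exact: integrable_EFinZ.
have i2 : mu.-integrable D (EFin \o (fun x => - gker s t c x + s * gker (s - 1) t c x)).
  exact: integrable_EFinD.
have := @Rintegral_pos_derive (gker s t c) _ 0 0 (fun x hx => is_derive_gker s t c hx) _ _
  (gker_cvg0 t c s0) (gker_cvgy t c s0).
rewrite subrr RintegralD// RintegralD//.
rewrite (_ : (\int[mu]_(x in D) - gker s t c x)%R = - Gm (s + 1) t c).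
  rewrite !RintegralZl// -!/(Gm _ _ _) => h; apply/eqP; rewrite -subr_eq0; apply/eqP.
  rewrite -[RHS]oppr0 -h; last 2 first.
  - move=> x x0; apply: continuousD; [apply: continuousD|].
    + by apply: continuousN; exact: continuous_gker.
    + by apply: continuousM; [exact: cvg_cst|exact: continuous_gker].
    + by apply: continuousM; [exact: cvg_cst|exact: continuous_gker].
  - exact: integrable_EFinD.
  by ring.
rewrite /Gm addrK -mulN1r -RintegralZl//; apply: eq_Rintegral => x _.
by rewrite mulN1r.
Qed.
End GammaKernel.

(** * Positivity for large real part, and propagation of zeros *)

Section GammaNonvanishing.
Context {R : realType}.
Notation mu := (@lebesgue_measure R).
Notation D := (`]0%R, +oo[%classic : set R).
Implicit Types (s t c x u : R).

Lemma sin_le_id u : 0 <= u -> sin u <= u.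
Proof.
rewrite le_eqVlt => /predU1P[<-|u0]; first by rewrite sin0.
have [z _] := @MVT R sin cos 0 u u0 (fun x _ => is_derive_sin x)
  (derivable_within_continuous (fun x _ => @ex_derive _ _ _ _ _ _ _ (is_derive_sin x))).
rewrite sin0 !subr0 => ->; rewrite -[leRHS]mul1r ler_wpM2r ?(ltW u0) ?cos_le1//.
Qed.

Lemma sqr_sin_le u : sin u ^+ 2 <= u ^+ 2.
Proof.
have h (v : R) : 0 <= v -> sin v ^+ 2 <= v ^+ 2.
  move=> v0; rewrite -[leLHS]real_normK ?num_real// lerXn2r ?nnegrE//.
  (* A negative sine forces [v > pi], and then [|sin v| <= 1 <= 2 <= pi < v]. *)
  have [s0|s0] := leP 0 (sin v); first by rewrite ger0_norm// sin_le_id.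
  have [v1|v1] := leP v pi.
    by have := @sin_ge0_pi _ v; rewrite v0 v1 => /(_ isT); rewrite leNgt s0.
  rewrite (le_trans (sin_max _))// (le_trans _ (ltW v1))// (le_trans _ (pi_ge2 _))//.
  by rewrite ler1n.
have [u0|u0] := leP 0 u; first exact: h.
by rewrite -sqrrN -sinN -[leRHS]sqrrN h// oppr_ge0 ltW.
Qed.

(** The half-angle formula reduces this to [sqr_sin_le]. *)
Lemma cos_ge_sqr u : 1 - u ^+ 2 / 2 <= cos u.
Proof.
have -> : cos u = 1 - 2 * sin (u / 2) ^+ 2.
  rewrite {1}(_ : u = (u / 2) *+ 2); last by rewrite -mulr_natr; field.
  by rewrite cos_mulr2n; have := cos2Dsin2 (u / 2); lra.
have := sqr_sin_le (u / 2); rewrite exprMn; lra.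
Qed.

(** With [u = e^(2 y)] the bracket is [(e^y - e^-y)^2], and [e^y - e^-y >= y] for [y >= 0]. Symmetry
    under [u |-> 1 / u] covers the remaining case. *)
Lemma sqr_ln_le u : 0 < u -> ln u ^+ 2 <= 4 * (u - 2 + u^-1).
Proof.
have h (w : R) : 0 <= w -> w ^+ 2 <= 4 * (expR w - 2 + expR (- w)).
  have [y ->] : exists y, w = y + y by exists (w / 2); rewrite -splitr.
  move=> w0; have y0 : 0 <= y by lra.
  have -> : expR (y + y) - 2 + expR (- (y + y)) = (expR y - expR (- y)) ^+ 2.
    rewrite !expRN expRD; have := expR_gt0 y; move: (expR y) => E E0.
    by field; rewrite gt_eqF.
  have -> : (y + y) ^+ 2 = 4 * y ^+ 2 by ring.
  have h1 : 1 + y <= expR y := expR_ge1Dx y.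
  have h2 : expR (- y) <= 1 by rewrite -[leRHS]expR0 ler_expR oppr_le0.
  have h3 : y <= expR y - expR (- y) by lra.
  by rewrite ler_pM2l// lerXn2r ?nnegrE// (le_trans y0).
move=> u0; rewrite -[in leRHS](lnK u0) -expRN.
have [l0|l0] := leP 0 (ln u); first exact: h.
rewrite -sqrrN (le_trans (h _ _)) ?oppr_ge0 ?(ltW l0)// opprK.
by lra.
Qed.

(* The parenthesis is the kernel times [(x - s)^2 / (s x)]: its integral is computed
   by the recurrence alone. *)
Lemma gker_ge s t x : 0 < s -> 0 < x ->
  gker (s - 1) 0 0 x - 2 * t ^+ 2 * (s^-1 * gker s 0 0 x - 2 * gker (s - 1) 0 0 x
     + s * gker (s - 1 - 1) 0 0 x) <= gker (s - 1) t (- (t * ln s)) x.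
Proof.
move=> s0 x0; rewrite /gker !mul0r !addr0 cos0 !mulr1.
rewrite !expR_lnB1//; set E := expR (s * ln x - x).
have E0 : 0 < E by exact: expR_gt0.
(* The phase is chosen to cancel the oscillation at [x = s], around which the mass concentrates. *)
have -> : t * ln x - t * ln s = t * ln (x / s) by rewrite ln_div ?posrE//; ring.
have h1 := cos_ge_sqr (t * ln (x / s)).
have h2 := @sqr_ln_le (x / s) (divr_gt0 x0 s0).
have h3 : 1 - 2 * t ^+ 2 * (x / s - 2 + (x / s)^-1) <= cos (t * ln (x / s)).
  apply: le_trans h1; rewrite exprMn lerD2l lerN2.
  have := ler_wpM2l (sqr_ge0 t) h2; lra.
apply: le_trans (ler_wpM2l _ h3); last by rewrite divr_ge0 ?ltW.
rewrite le_eqVlt; apply/orP; left; apply/eqP; field.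
by rewrite !gt_eqF.
Qed.

(** On [[1, 2]] the factor [x^(s - 1)] is at least 1, so the integrand is at least [e^-2] there. *)
Lemma Gm_gt0 s : 1 <= s -> 0 < Gm s 0 0.
Proof.
move=> s1; have ig : mu.-integrable D (EFin \o gker (s - 1) 0 0).
  by apply: integrable_gker; lra.
have g0 x : 0 <= gker (s - 1) 0 0 x.
  by rewrite /gker mul0r addr0 cos0 mulr1 expR_ge0.
have sD : `[1, 2]%classic `<=` D by exact: seg_sub_pos.
apply: (@lt_le_trans _ _ (expR (- 2))); first exact: expR_gt0.
rewrite -lee_fin /Gm /Rintegral fineK; last exact: integrable_fin_num.
apply: (@le_trans _ _ (\int[mu]_(x in `[1%R, 2%R]) (gker (s - 1) 0 0 x)%:E)%E); last first.
  apply: ge0_subset_integral => //; first exact: measurable_int ig.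
  by move=> x _; rewrite lee_fin.
apply: (@le_trans _ _ (\int[mu]_(x in `[1%R, 2%R]) (cst (expR (- 2))%:E) x)%E).
  rewrite integral_cst//= lebesgue_measure_itv/= lte_fin ltr1n/= -EFinB -EFinM lee_fin.
  by rewrite (_ : 2 - 1 = 1 :> R) ?mulr1//; ring.
apply: ge0_le_integral => //=.
- by apply: measurable_funS (measurable_int _ ig).
- move=> x; rewrite in_itv/= => /andP[x1 x2].
  rewrite lee_fin /gker mul0r addr0 cos0 mulr1 ler_expR.
  have h : 0 <= (s - 1) * ln x by rewrite mulr_ge0 ?ln_ge0 ?subr_ge0.
  lra.
Qed.

(** By the addition formula for the cosine; two phases thus determine all of them. *)
Lemma Gm_phase s t c : 0 < s ->
  Gm s t c = cos c * Gm s t 0 + sin c * Gm s t (pi / 2).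
Proof.
move=> s0; rewrite /Gm -!RintegralZl//; last 2 first.
- by apply: integrable_gker; lra.
- by apply: integrable_gker; lra.
rewrite -RintegralD//; last 2 first.
- by apply: integrable_EFinZ => //; apply: integrable_gker; lra.
- by apply: integrable_EFinZ => //; apply: integrable_gker; lra.
apply: eq_Rintegral => x _.
by rewrite /gker addr0 cosDpihalf cosD; ring.
Qed.

(** Integrating [gker_ge], the recurrence evaluates the correction to [2 t^2 Gamma(s) / (s - 1)],
    which leaves [Gamma(s) (1 - 2 t^2 / (s - 1))]. *)
Lemma Gm_gt0_large s t : 1 < s -> 2 * t ^+ 2 < s - 1 -> 0 < Gm s t (- (t * ln s)).
Proof.
move=> s1 ts; have s0 : 0 < s by lra.
have a0 : -1 < s by lra.
have a1 : -1 < s - 1 by lra.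
have a2 : -1 < s - 1 - 1 by lra.
have s10 : 0 < s - 1 by lra.
have G0 := @Gm_gt0 s (ltW s1).
have G1 : Gm (s + 1) 0 0 = s * Gm s 0 0 by rewrite Gm_rec// mul0r addr0.
have G2 : Gm s 0 0 = (s - 1) * Gm (s - 1) 0 0.
  by rewrite -[in LHS](subrK 1 s) Gm_rec// mul0r addr0.
have i u s' t' c' : -1 < s' -> mu.-integrable D (EFin \o (fun x => u * gker s' t' c' x)).
  by move=> ?; apply: integrable_EFinZ => //; exact: integrable_gker.
have i1 := integrable_EFinB (measurable_itv _) (i s^-1 _ 0 0 a0) (i 2 _ 0 0 a1).
have i2 := integrable_EFinD (measurable_itv _) i1 (i s _ 0 0 a2).
have i3 := integrable_EFinZ (2 * t ^+ 2) (measurable_itv _) i2.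
have i4 := integrable_gker 0 0 a1.
have i5 := integrable_EFinB (measurable_itv _) i4 i3.
move: (i5); set g := (X in EFin \o X) => ig.
apply: (@lt_le_trans _ _ (\int[mu]_(x in D) g x)%R); last first.
  apply: le_Rintegral => //; first exact: integrable_gker.
  by move=> x; rewrite /= in_itv/= andbT => x0; exact: gker_ge.
rewrite /g => {g ig}.
rewrite RintegralB// RintegralZl// RintegralD//; last exact: i.
rewrite RintegralB//; [|exact: i..].
rewrite !RintegralZl//; [|exact: integrable_gker..].
have GS : (\int[mu]_(x in D) gker s 0 0 x)%R = s * Gm s 0 0 by rewrite -G1 /Gm addrK.
rewrite GS mulKf ?gt_eqF// -/(Gm s 0 0) -/(Gm (s - 1) 0 0).
have -> : Gm (s - 1) 0 0 = Gm s 0 0 / (s - 1) by rewrite G2 mulrC mulKf// gt_eqF.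
move: (Gm s 0 0) G0 => G G0; move: s10 ts; move: (s - 1) (subrK 1 s) => r <- r0 ts.
have -> : G - 2 * t ^+ 2 * (G - 2 * G + (r + 1) * (G / r))
   = G * (1 - 2 * t ^+ 2 / r) by field; rewrite gt_eqF.
by rewrite mulr_gt0// subr_gt0 ltr_pdivrMr// mul1r.
Qed.

Lemma Gm_neq0 s t : 0 < s -> ~ (Gm s t 0 = 0 /\ Gm s t (pi / 2) = 0).
Proof.
move=> s0 [h1 h2].
(* All phases are carried through the induction at once, because the recurrence moves [c] to
   [c + pi / 2]. *)
have h n c : Gm (s + n%:R) t c = 0.
  elim: n c => [|n IH] c.
    by rewrite addr0 Gm_phase// h1 h2 !mulr0 addr0.
  rewrite -natr1 addrA Gm_rec; last by rewrite ltr_wpDr.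
  by rewrite !IH !mulr0 addr0.
(* Large enough for [s + n - 1] to exceed [2 t^2], where positivity contradicts vanishing. *)
pose n := (Num.truncn (1 + 2 * t ^+ 2)).+1.
have n1 : 1 + 2 * t ^+ 2 < n%:R by exact: truncnS_gt.
have t0 := sqr_ge0 t.
have s1 : 1 < s + n%:R by lra.
have s2 : 2 * t ^+ 2 < s + n%:R - 1 by lra.
by have := Gm_gt0_large s1 s2; rewrite h ltxx.
Qed.
End GammaNonvanishing.

(** * Complex exponentials and integrals *)

Section ComplexIntegral.
Context {R : realType}.
Notation mu := (@lebesgue_measure R).
Notation D := (`]0%R, +oo[%classic : set R).
Implicit Types (z s : R[i]) (g : R -> R[i]).

Lemma ReM z1 z2 : Re (z1 * z2) = Re z1 * Re z2 - Im z1 * Im z2.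
Proof. by case: z1; case: z2. Qed.
Lemma ImM z1 z2 : Im (z1 * z2) = Re z1 * Im z2 + Im z1 * Re z2.
Proof. by case: z1; case: z2. Qed.

Lemma complex_eqP z1 z2 : Re z1 = Re z2 -> Im z1 = Im z2 -> z1 = z2.
Proof. by case: z1; case: z2 => /= ? ? ? ? -> ->. Qed.

Lemma mem_pos (x : R) : x \in D -> 0 < x.
Proof. by rewrite inE/= in_itv/= andbT. Qed.

Lemma cexpD z1 z2 : cexp (z1 + z2) = cexp z1 * cexp z2.
Proof.
by apply: complex_eqP; rewrite /cexp ?ReM ?ImM/= ?ReD ?ImD expRD ?cosD ?sinD; ring.
Qed.

Lemma cexp0 : cexp 0 = 1 :> R[i].
Proof. by rewrite /cexp/= expR0 cos0 sin0 mulr1 mulr0. Qed.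

Lemma cexp_neq0 z : cexp z != 0.
Proof.
apply: contra_eq_neq (_ : cexp z * cexp (- z) = 1) => [->|].
  by rewrite mul0r eq_sym oner_eq0.
by rewrite -cexpD subrr cexp0.
Qed.

Lemma cexpN z : cexp (- z) = (cexp z)^-1.
Proof.
by apply: (mulfI (cexp_neq0 z)); rewrite -cexpD subrr cexp0 mulfV// cexp_neq0.
Qed.

Lemma cexp_real (x : R) : cexp x%:C = (expR x)%:C.
Proof. by rewrite /cexp/= cos0 sin0 mulr1 mulr0. Qed.

Lemma normc_real (x : R) : normc x%:C = `|x|.
Proof. by rewrite normcE_sqrt/= expr0n/= addr0 sqrtr_sqr. Qed.

Lemma Log_pos (x : R) : 0 < x -> Log x%:C = (ln x)%:C.
Proof.
move=> x0; rewrite /Log /Arg normc_real gtr0_norm//= lexx divff ?gt_eqF//.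
by rewrite acos1.
Qed.

Lemma cpow_posE (x : R) s : 0 < x -> cpow x%:C s = cexp (s * (ln x)%:C).
Proof. by move=> x0; rewrite /cpow Log_pos. Qed.

Lemma cpow_posM (x y : R) s : 0 < x -> 0 < y ->
  cpow (x * y)%:C s = cpow x%:C s * cpow y%:C s.
Proof.
move=> x0 y0; rewrite !cpow_posE ?mulr_gt0// lnM ?posrE// rmorphD mulrDr.
exact: cexpD.
Qed.

Lemma cpow_posB1 (x : R) s : 0 < x -> cpow x%:C (s - 1) = cpow x%:C s / x%:C.
Proof.
move=> x0; rewrite !cpow_posE// mulrBl mul1r cexpD cexpN cexp_real lnK//.
Qed.

Lemma cpow_pos_neq0 (x : R) s : 0 < x -> cpow x%:C s != 0.
Proof. by move=> x0; rewrite cpow_posE// cexp_neq0. Qed.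

Lemma gamma_integrandE s (x : R) : 0 < x ->
  cexp (- x%:C) * cpow x%:C (s - 1) =
  gker (Re s - 1) (Im s) 0 x +i* gker (Re s - 1) (Im s) (- (pi / 2)) x.
Proof.
move=> x0; rewrite cpow_posE// -cexpD /cexp /gker cosBpihalf addr0.
have -> : Re (- x%:C + (s - 1) * (ln x)%:C) = (Re s - 1) * ln x - x.
  by case: s => u v /=; ring.
have -> : Im (- x%:C + (s - 1) * (ln x)%:C) = Im s * ln x.
  by case: s => u v /=; ring.
by [].
Qed.

Lemma cintegrable_gamma s : 0 < Re s ->
  cintegrable D (fun x => cexp (- x%:C) * cpow x%:C (s - 1)).
Proof.
move=> s0; split.
- suff : mu.-integrable D (EFin \o gker (Re s - 1) (Im s) 0).
    by apply: eq_integrable => // x /mem_pos x0; rewrite gamma_integrandE.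
  by apply: integrable_gker; lra.
- suff : mu.-integrable D (EFin \o gker (Re s - 1) (Im s) (- (pi / 2))).
    by apply: eq_integrable => // x /mem_pos x0; rewrite gamma_integrandE.
  by apply: integrable_gker; lra.
Qed.

Lemma euler_gammaE s : 0 < Re s ->
  euler_gamma s = cintegral D (fun x => cexp (- x%:C) * cpow x%:C (s - 1)).
Proof.
move=> s0; rewrite /euler_gamma improper_integralE//.
exact: cintegrable_gamma.
Qed.

Lemma euler_gamma_Gm s : 0 < Re s ->
  euler_gamma s = Gm (Re s) (Im s) 0 +i* Gm (Re s) (Im s) (- (pi / 2)).
Proof.
move=> s0; rewrite euler_gammaE//; congr (_ +i* _);
  by apply: eq_Rintegral => x /mem_pos x0; rewrite gamma_integrandE.
Qed.

Lemma euler_gamma_neq0 s : 0 < Re s -> euler_gamma s != 0.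
Proof.
move=> s0; apply/eqP; rewrite euler_gamma_Gm// => -[h1 h2].
apply: (@Gm_neq0 _ _ (Im s) s0); split=> //.
move: h2; rewrite Gm_phase// h1 mulr0 add0r sinN sin_pihalf mulN1r => /eqP.
by rewrite oppr_eq0 => /eqP.
Qed.

Lemma cintegrableZ (A : set R) z g : measurable A -> cintegrable A g ->
  cintegrable A (fun x => z * g x).
Proof.
move=> mA [h1 h2]; split.
- suff : mu.-integrable A (EFin \o (fun x => Re z * Re (g x) - Im z * Im (g x))).
    by apply: eq_integrable => // x _; rewrite /= ReM.
  by apply: integrable_EFinB => //; exact: integrable_EFinZ.
- suff : mu.-integrable A (EFin \o (fun x => Re z * Im (g x) + Im z * Re (g x))).
    by apply: eq_integrable => // x _; rewrite /= ImM.
  by apply: integrable_EFinD => //; exact: integrable_EFinZ.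
Qed.

Lemma cintegralZ (A : set R) z g : measurable A -> cintegrable A g ->
  cintegral A (fun x => z * g x) = z * cintegral A g.
Proof.
move=> mA [h1 h2]; apply: complex_eqP; rewrite ?ReM ?ImM/=.
- rewrite -!RintegralZl// -RintegralB//; try exact: integrable_EFinZ.
  by apply: eq_Rintegral => x _; rewrite ReM.
- rewrite -!RintegralZl// -RintegralD//; try exact: integrable_EFinZ.
  by apply: eq_Rintegral => x _; rewrite ImM.
Qed.

Lemma cintegralD (A : set R) g1 g2 :
  measurable A -> cintegrable A g1 -> cintegrable A g2 ->
  cintegrable A (fun x => g1 x + g2 x) /\
  cintegral A (fun x => g1 x + g2 x) = cintegral A g1 + cintegral A g2.
Proof.
move=> mA [h1 h2] [k1 k2]; split; [split|].
- suff : mu.-integrable A (EFin \o (fun x => Re (g1 x) + Re (g2 x))).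
    by apply: eq_integrable => // x _; rewrite /= ReD.
  exact: integrable_EFinD.
- suff : mu.-integrable A (EFin \o (fun x => Im (g1 x) + Im (g2 x))).
    by apply: eq_integrable => // x _; rewrite /= ImD.
  exact: integrable_EFinD.
- apply: complex_eqP; rewrite ?ReD ?ImD/= -RintegralD//; apply: eq_Rintegral => x _.
  + by rewrite ReD.
  + by rewrite ImD.
Qed.

Lemma cintegral0 (A : set R) : measurable A ->
  cintegrable A (fun=> 0 : R[i]) /\ cintegral A (fun=> 0) = 0 :> R[i].
Proof.
move=> mA; split; first by split; exact: integrable0.
by rewrite /cintegral /Rintegral/= integral0.
Qed.

Lemma cintegral_sum (I : finType) (A : set R) (g : I -> R -> R[i]) : measurable A ->
  (forall i, cintegrable A (g i)) ->
  cintegral A (fun x => \sum_i g i x) = \sum_i cintegral A (g i).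
Proof.
move=> mA ig.
(* Integrability travels with the formula, since additivity at the next step requires it. *)
suff h (r : seq I) : cintegrable A (fun x => \sum_(i <- r) g i x) /\
    cintegral A (fun x => \sum_(i <- r) g i x) = \sum_(i <- r) cintegral A (g i).
  exact: (h _).2.
elim: r => [|i r [IH1 IH2]].
  rewrite big_nil (_ : (fun x => _) = fun=> 0); first exact: cintegral0.
  by apply/funext => x; rewrite big_nil.
rewrite big_cons -IH2 (_ : (fun x => _) = (fun x => g i x + \sum_(j <- r) g j x)).
  exact: cintegralD.
by apply/funext => x; rewrite big_cons.
Qed.

Lemma eq_cintegrable (A : set R) g1 g2 : measurable A -> {in A, g1 =1 g2} ->
  cintegrable A g1 -> cintegrable A g2.
Proof.
move=> mA h [h1 h2]; split.
- by move: h1; apply: eq_integrable => // x xA; rewrite h.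
- by move: h2; apply: eq_integrable => // x xA; rewrite h.
Qed.

Lemma eq_cintegral (A : set R) g1 g2 : {in A, g1 =1 g2} ->
  cintegral A g1 = cintegral A g2.
Proof.
by move=> h; congr (_ +i* _); apply: eq_Rintegral => x xA; rewrite h.
Qed.
End ComplexIntegral.

(** * Measurability and substitution for complex integrands *)

Section ComplexSubstitution.
Context {R : realType}.
Notation mu := (@lebesgue_measure R).
Notation D := (`]0%R, +oo[%classic : set R).
Implicit Types (z s : R[i]) (g : R -> R[i]).

Lemma cintegrable_measurable g : cintegrable D g -> cmeasurable D g.
Proof.
by move=> [h1 h2]; split; apply/measurable_EFinP;
  [exact: measurable_int h1|exact: measurable_int h2].
Qed.

Lemma cmeasurableM g1 g2 : cmeasurable D g1 -> cmeasurable D g2 ->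
  cmeasurable D (fun x => g1 x * g2 x).
Proof.
move=> [r1 i1] [r2 i2]; split.
- rewrite (_ : (fun x => _) = (fun x => Re (g1 x) * Re (g2 x) - Im (g1 x) * Im (g2 x))).
    by apply: measurable_funB; apply: measurable_funM.
  by apply/funext => x; rewrite ReM.
- rewrite (_ : (fun x => _) = (fun x => Re (g1 x) * Im (g2 x) + Im (g1 x) * Re (g2 x))).
    by apply: measurable_funD; apply: measurable_funM.
  by apply/funext => x; rewrite ImM.
Qed.

Lemma cmeasurable_real (h : R -> R) : measurable_fun D h ->
  cmeasurable D (fun x => (h x)%:C).
Proof. by move=> mh; split => //=; exact: measurable_cst. Qed.

Lemma cmeasurable_cst z : cmeasurable D (fun=> z).
Proof. by split; exact: measurable_cst. Qed.

Lemma cintegrable_normc g : cmeasurable D g ->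
  (\int[mu]_(x in D) (normc (g x))%:E < +oo)%E -> cintegrable D g.
Proof.
move=> mg lt.
have ig : mu.-integrable D (EFin \o (fun x => normc (g x))).
  apply/integrableP; split; first by apply/measurable_EFinP; exact: measurable_normc.
  by under eq_integral do rewrite /= ger0_norm ?normc_ge0//.
case: mg => mr mi; split; apply: le_integrable ig => //.
- by apply/measurable_EFinP; exact: mr.
- by move=> x _; rewrite lee_fin/= [leRHS]ger0_norm ?normc_ge0// normc_ge_normRe.
- by apply/measurable_EFinP; exact: mi.
- by move=> x _; rewrite lee_fin/= [leRHS]ger0_norm ?normc_ge0// normc_ge_normIm.
Qed.

(** Improper convergence provides integrability on compact segments only; countably many of them
    cover the half-line. *)
Lemma improper_cvg_measurable g : improper_cvg g -> cmeasurable D g.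
Proof.
move=> [ig _]; rewrite /cmeasurable -bigcup_posseg.
have n0 (n : nat) : 0 < n.+1%:R^-1 :> R by rewrite invr_gt0.
have n1 (n : nat) : n.+1%:R^-1 <= n.+1%:R :> R.
  by rewrite (@le_trans _ _ 1)// ?invf_le1// ler1n.
have mseg n : measurable (@posseg R n) by exact: measurable_itv.
split; apply/measurable_fun_bigcup => // n; have [h1 h2] := ig _ _ (n0 n) (n1 n).
- by apply/measurable_EFinP; exact: measurable_int h1.
- by apply/measurable_EFinP; exact: measurable_int h2.
Qed.

Section substitution.
Variables (F w : R -> R).
Hypothesis mF : measurable_fun D F.
Hypothesis mw : measurable_fun D w.
Hypothesis w0 : forall y, 0 < y -> 0 <= w y.
Hypothesis F0 : forall y, 0 < y -> 0 < F y.
Hypothesis FE : forall c : R, 0 < c ->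
  (\int[mu]_(y in D `&` F @^-1` `]0%R, c]) (w y)%:E = c%:E)%E.

Lemma cmeasurable_substitution g : cmeasurable D g ->
  cmeasurable D (fun y => g (F y) * (w y)%:C).
Proof.
move=> [mr mi]; apply: cmeasurableM; last exact: cmeasurable_real.
have FD : F @` D `<=` D.
  by move=> _ [y + <-]; rewrite /= !in_itv/= !andbT; exact: F0.
by split; [apply: (measurable_comp _ FD mr)|apply: (measurable_comp _ FD mi)].
Qed.

Lemma cintegral_substitution g : cmeasurable D g ->
  cintegral D (fun y => g (F y) * (w y)%:C) = cintegral D g.
Proof.
move=> [mr mi]; congr (_ +i* _).
- rewrite -(Rintegral_substitution mF mw w0 F0 FE mr).
  by apply: eq_Rintegral => y _; rewrite ReM/= mulr0 subr0.
- rewrite -(Rintegral_substitution mF mw w0 F0 FE mi).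
  by apply: eq_Rintegral => y _; rewrite ImM/= mulr0 add0r.
Qed.

(** The modulus is substituted as a nonnegative function, and [|Re g| + |Im g|] bounds the
    result. *)
Lemma cintegrable_substitution g : cintegrable D g ->
  cintegrable D (fun y => g (F y) * (w y)%:C).
Proof.
move=> ig; have mg := cintegrable_measurable ig.
apply: cintegrable_normc; first exact: cmeasurable_substitution.
have -> : (\int[mu]_(x in D) (normc (g (F x) * (w x)%:C))%:E =
    \int[mu]_(x in D) ((EFin \o (fun v => normc (g v))) (F x) * (w x)%:E))%E.
  apply: eq_integral => x /mem_pos x0.
  by rewrite normcM normc_real ger0_norm ?w0// EFinM.
rewrite (ge0_integral_substitution mF mw w0 F0 FE).
- pose h x := `|Re (g x)| + `|Im (g x)|.
  have ih : mu.-integrable D (EFin \o h).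
    by apply: integrable_EFinD => //; case: ig => i1 i2; exact: integrable_norm.
  apply: (@le_lt_trans _ _ (\int[mu]_(x in D) (EFin \o h) x)%E).
    apply: ge0_le_integral => //=.
    + by move=> x _; rewrite lee_fin normc_ge0.
    + by apply/measurable_EFinP; exact: measurable_normc.
    + exact: measurable_int ih.
    + by move=> x _; rewrite lee_fin normc_le_norm2.
  by apply: integrable_lty ih.
- by apply/measurable_EFinP; exact: measurable_normc.
- by move=> y _; rewrite lee_fin normc_ge0.
Qed.
End substitution.

Section scaling.
Variable l : R.
Hypothesis l0 : 0 < l.

Let mF : measurable_fun D (fun y => l * y). Proof. exact: measurable_funM. Qed.
Let mw : measurable_fun D (cst l). Proof. exact: measurable_cst. Qed.
Let F0 y : 0 < y -> 0 < l * y. Proof. by move=> y0; rewrite mulr_gt0. Qed.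
Let w0 y : 0 < y -> 0 <= (cst l : R -> R) y. Proof. by move=> _; exact: ltW. Qed.
Let FE (c : R) : 0 < c ->
  (\int[mu]_(y in D `&` (fun y => (l * y)%R) @^-1` `]0%R, c]) ((cst l : R -> R) y)%:E = c%:E)%E.
Proof.
move=> c0; have -> : D `&` (fun y => l * y) @^-1` `]0%R, c] = `]0, c / l]%classic.
  apply/seteqP; split => y /=; rewrite !in_itv/= andbT pmulr_rgt0// ler_pdivlMr// mulrC.
    by move=> [-> /andP[_ ->]].
  by move=> /andP[-> ->].
transitivity (\int[mu]_(y in `]0%R, (c / l)%R]) (cst l%:E) y)%E; first by [].
rewrite integral_cst//= lebesgue_measure_itv/= lte_fin divr_gt0// -EFinB -EFinM subr0.
by rewrite mulrCA divff ?gt_eqF// mulr1.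
Qed.

Lemma cintegral_scaling g : cmeasurable D g ->
  cintegral D (fun y => g (l * y) * l%:C) = cintegral D g.
Proof. exact: (cintegral_substitution mF mw w0 F0 FE). Qed.

Lemma cintegrable_scaling g : cintegrable D g ->
  cintegrable D (fun y => g (l * y) * l%:C).
Proof. exact: (cintegrable_substitution mF mw w0 F0 FE). Qed.
End scaling.

Section inversion.
Let cV (y : R) : 0 < y -> {for y, continuous (@GRing.inv R)}.
Proof. by move=> y0; apply: inv_continuous; rewrite gt_eqF. Qed.
Let cW (y : R) : 0 < y -> {for y, continuous (fun x : R => x^-1 * x^-1)}.
Proof. by move=> y0; apply: continuousM; exact: cV. Qed.
Let mF : measurable_fun D (@GRing.inv R).
Proof. by apply: measurable_fun_pos => y; exact: cV. Qed.
Let mw : measurable_fun D (fun y : R => y^-1 * y^-1).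
Proof. by apply: measurable_fun_pos => y; exact: cW. Qed.
Let F0 (y : R) : 0 < y -> 0 < y^-1. Proof. by rewrite invr_gt0. Qed.
Let w0 (y : R) : 0 < y -> 0 <= y^-1 * y^-1.
Proof. by move=> y0; rewrite mulr_ge0// invr_ge0 ltW. Qed.

Let dF (y : R) : 0 < y -> is_derive y 1 (fun x : R => - x^-1) (y^-1 * y^-1).
Proof.
move=> y0; have n0 : id y != 0 by rewrite /= gt_eqF.
have h := is_deriveN (is_deriveV n0 (is_derive_id y 1)).
apply: (@is_derive_eq _ _ _ _ _ _ _ _ h).
rewrite -[LHS]/(- (- y ^- 2 * 1)); field.
by rewrite gt_eqF.
Qed.

(** The preimage of []0, c]] is [[1 / c, +oo[], on which the primitive [- 1 / y] rises from [- c] to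
    [0]. *)
Let FE (c : R) : 0 < c ->
  (\int[mu]_(y in D `&` (@GRing.inv R) @^-1` `]0%R, c]) (y^-1 * y^-1)%:E = c%:E)%E.
Proof.
move=> c0; have ci0 : 0 < c^-1 by rewrite invr_gt0.
have -> : D `&` (@GRing.inv R) @^-1` `]0%R, c] = `[c^-1, +oo[%classic.
  apply/seteqP; split => y /=; rewrite !in_itv/= !andbT.
    by move=> [y0 /andP[_ yc]]; rewrite -[leRHS]invrK lef_pV2 ?posrE ?invr_gt0.
  move=> cy; have y0 := lt_le_trans ci0 cy; split=> //.
  by rewrite invr_gt0 y0/= -[leRHS]invrK lef_pV2 ?posrE.
have pos y : c^-1 <= y -> 0 < y by exact: lt_le_trans.
rewrite (@ge0_continuous_FTC2y _ (fun y : R => y^-1 * y^-1) (fun y => - y^-1) _ 0).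
- by rewrite invrK -EFinB opprK add0r.
- by move=> y /pos; exact: w0.
- by apply: continuous_in_subspaceT => y; rewrite inE/= in_itv/= andbT => /pos; exact: cW.
- rewrite -oppr0; apply: cvgN.
  by apply: (gtr0_cvgV0 (f := id) _).2; [exact: nbhs_pinfty_gt|exact: cvg_id].
- by move=> y /ltW/pos y0; have := dF y0 => ?; exact: ex_derive.
- by apply: cvg_at_right_filter; exact: is_derive_cvg (dF ci0).
- move=> y; rewrite in_itv/= andbT => /ltW/pos y0.
  by rewrite derive1E; have := dF y0 => ?; exact: derive_val.
Qed.

Lemma cintegral_inversion g : cmeasurable D g ->
  cintegral D (fun y => g y^-1 * (y^-1 * y^-1)%:C) = cintegral D g.
Proof. exact: (cintegral_substitution mF mw w0 F0 FE). Qed.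
End inversion.
End ComplexSubstitution.

(** * Laplace transforms and L-series *)

Section LSeries.
Context {R : realType}.
Notation mu := (@lebesgue_measure R).
Notation D := (`]0%R, +oo[%classic : set R).
Implicit Types (z s : R[i]) (g : R -> R[i]).

Lemma real_complexM (x y : R) : (x * y)%:C = x%:C * y%:C.
Proof. by apply: complex_eqP => /=; ring. Qed.

Lemma real_complexN (x : R) : (- x)%:C = - x%:C.
Proof. by apply: complex_eqP => /=; rewrite ?oppr0. Qed.

Lemma real_complexV (x : R) : (x^-1)%:C = x%:C^-1.
Proof. exact: (fmorphV (real_complex R)). Qed.

Lemma real_complex_eq0 (x : R) : (x%:C == 0) = (x == 0).
Proof. by rewrite eq_complex/= eqxx andbT. Qed.

Lemma inv_gamma_posE s : 0 < Re s -> inv_gamma s = (euler_gamma s)^-1.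
Proof. by move=> s0; rewrite /inv_gamma s0 big_ord0 addr0 mul1r. Qed.

(** Euler's integral is rescaled by [L = 2 pi l]. The powers of [2 pi] cancel against the
    normalisation in [I_test], leaving [l^-s] times [Gamma(s) / Gamma(s)]. *)
Lemma laplace_I_test s (l : R) : 0 < Re s -> 0 < l ->
  laplace_cvg (I_test s) (2 * pi * l)%:C /\
  laplace (I_test s) (2 * pi * l)%:C = (cpow l%:C s)^-1.
Proof.
move=> s0 l0; have p0 : 0 < 2 * pi :> R by rewrite mulr_gt0// pi_gt0.
set L := 2 * pi * l; have L0 : 0 < L by rewrite mulr_gt0.
pose G x := cexp (- x%:C) * cpow x%:C (s - 1) : R[i].
pose K := inv_gamma s / cpow l%:C s.
have iG : cintegrable D G by exact: cintegrable_gamma.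
have iGL := cintegrable_scaling L0 iG.
have E : {in D, (fun t => K * (G (L * t) * L%:C)) =1
    (fun t => cexp (- L%:C * t%:C) * I_test s t)}.
  move=> t /mem_pos t0; rewrite /G /K /I_test.
  have -> : cexp (- (L * t)%:C) = cexp (- L%:C * t%:C) by rewrite real_complexM mulNr.
  rewrite (cpow_posM _ L0 t0) (cpow_posB1 _ L0) (cpow_posM _ p0 l0).
  have h1 : cpow l%:C s != 0 by exact: cpow_pos_neq0.
  have h2 : L%:C != 0 by rewrite real_complex_eq0 gt_eqF.
  by field; rewrite h1 h2.
have iI : cintegrable D (fun t => cexp (- L%:C * t%:C) * I_test s t).
  by apply: (eq_cintegrable _ E) => //; exact: cintegrableZ.
split; first exact: cintegrable_improper_cvg.
rewrite /laplace improper_integralE// -(eq_cintegral E) cintegralZ//.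
rewrite (cintegral_scaling L0 (cintegrable_measurable iG)) -/G -euler_gammaE//.
(* Inversion is total with [0^-1 = 0], so this cancellation rests on the nonvanishing of Gamma. *)
rewrite /K inv_gamma_posE// mulrAC mulVf ?mul1r//.
exact: euler_gamma_neq0.
Qed.

(** The real and imaginary series converge absolutely by comparison with the moduli. *)
Lemma normal_series_cvg (u : nat -> R[i]) :
  (\sum_(0 <= n <oo) (normc (u n))%:E < +oo)%E ->
  cvgn (series (u : nat -> R[i]^o)).
Proof.
move=> su.
have n0 n : 0 <= normc (u n) by exact: normc_ge0.
have cn : cvgn (series (fun n => normc (u n))).
  apply: nondecreasing_is_cvgn.
    by apply: nondecreasing_series => n _ _; exact: n0.
  have fs : (\sum_(0 <= n <oo) (normc (u n))%:E \is a fin_num)%E.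
    by rewrite ge0_fin_numE// nneseries_ge0// => n _ _; rewrite lee_fin.
  exists (fine (\sum_(0 <= n <oo) (normc (u n))%:E)%E) => _ [n _ <-].
  rewrite -lee_fin fineK// /series/= -sumEFin.
  by apply: nneseries_lim_ge => k _ _; rewrite lee_fin.
have cr (v : nat -> R) : (forall n, `|v n| <= normc (u n)) -> cvgn (series v).
  by move=> vu; apply: normed_cvg;
    exact: (series_le_cvg (fun n => normr_ge0 (v n)) n0 vu cn).
have /cvg_ex[/= lr hr] := cr (fun n => Re (u n)) (fun n => normc_ge_normRe _).
have /cvg_ex[/= li hi] := cr (fun n => Im (u n)) (fun n => normc_ge_normIm _).
apply/cvg_ex; exists (lr +i* li); apply/cvg_complexP; split.
- rewrite (_ : (fun t => Re _) = series (fun n => Re (u n)))//.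
  by apply/funext => n; rewrite /series/=; apply: (big_morph _ ReD).
- rewrite (_ : (fun t => Im _) = series (fun n => Im (u n)))//.
  by apply/funext => n; rewrite /series/=; apply: (big_morph _ ImD).
Qed.

(** The series is the part of the unordered sum over [range i]. Taking [Posz] and [Negz] for [i]
    controls both halves of a sum over the integers. *)
Lemma nneseries_le_esum (T : choiceType) (i : nat -> T) (u : T -> \bar R) :
  injective i -> (forall n, 0 <= u n)%E ->
  (\sum_(0 <= n <oo) u (i n) <= \esum_(n in [set: T]) u n)%E.
Proof.
move=> inj_i u0; rewrite nneseries_esumT//.
rewrite -(@reindex_esum _ _ _ setT (range i) i u); last first.
  split; [by move=> n _ /=; exists n| |by []].
  by move=> x y _ _; exact: inj_i.
rewrite esum_mkcond; apply: le_esum => x _; case: ifPn => //.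
Qed.

Lemma zsum_abs_cvgP (u : int -> R[i]) : zsum_abs_cvg u -> zsum_cvg u.
Proof.
move=> su; split; apply: normal_series_cvg; apply: le_lt_trans su.
- apply: (@nneseries_le_esum _ Posz (fun n => (normc (u n))%:E)) => [x y []//|n].
  by rewrite lee_fin normc_ge0.
- apply: (@nneseries_le_esum _ Negz (fun n => (normc (u n))%:E)) => [x y []//|n].
  by rewrite lee_fin normc_ge0.
Qed.

Lemma limn_complex (u : nat -> R[i]^o) (l : R[i]^o) : u @ \oo --> l -> limn u = l.
Proof. by apply: cvg_lim; exact: norm_hausdorff. Qed.

(** The two halves are integrated termwise separately, in keeping with [zsum] being a sum of two
    limits. *)
Lemma cintegral_zsum (g : int -> R -> R[i]) (GP GN : R -> R[i]) :
  (forall n, cmeasurable D (g n)) ->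
  (\esum_(n in [set: int]) \int[mu]_(t in D) (normc (g n t))%:E < +oo)%E ->
  (forall t, 0 < t -> series (fun n => g (Posz n) t : R[i]^o) @ \oo --> (GP t : R[i]^o)) ->
  (forall t, 0 < t -> series (fun n => g (Negz n) t : R[i]^o) @ \oo --> (GN t : R[i]^o)) ->
  cintegrable D (fun t => GP t + GN t) /\
  zsum (fun n => cintegral D (g n)) = cintegral D (fun t => GP t + GN t).
Proof.
move=> mg sg cP cN.
have I0 n : (0 <= \int[mu]_(t in D) (normc (g n t))%:E)%E.
  by apply: integral_ge0 => t _; rewrite lee_fin normc_ge0.
have Dpos t : D t -> 0 < t by rewrite /= in_itv/= andbT.
have [|t /Dpos t0|iP hP] := @cvg_series_cintegral _ D (measurable_itv _)
    (fun n => g (Posz n)) GP (fun n => mg _).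
- by apply: le_lt_trans sg; apply: (@nneseries_le_esum _ Posz) => [x y []//|n]; exact: I0.
- exact: cP.
have [|t /Dpos t0|iN hN] := @cvg_series_cintegral _ D (measurable_itv _)
    (fun n => g (Negz n)) GN (fun n => mg _).
- by apply: le_lt_trans sg; apply: (@nneseries_le_esum _ Negz) => [x y []//|n]; exact: I0.
- exact: cN.
have [iPN ->] := cintegralD (measurable_itv _) iP iN.
split; first exact: iPN.
by rewrite /zsum (limn_complex hP) (limn_complex hN).
Qed.

Section test_functions.
Variables (m : nat) (kappa : 'I_m -> R) (f : R[i] -> 'cV[R[i]]_m).
Variables (a : 'I_m -> int -> R[i]) (n0 : nat).
Hypothesis ha : fourier_expansion kappa f a.

(** The second condition of [test_space] is exactly the absolute summability that termwise
    integration of the Fourier series against [phi] requires. *)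
Lemma L_testE (phi : R -> R[i]) j : test_space n0 kappa a phi ->
  cintegrable D (fun y => phi y * f (y *i) j 0) /\
  L_test kappa a phi j 0 = cintegral D (fun y => phi y * f (y *i) j 0).
Proof.
move=> [lphi sphi].
have mphi : cmeasurable D phi.
  (* At [s = 0] the Laplace kernel is 1, so convergence there yields the measurability of [phi]
     itself. *)
  have /lphi/improper_cvg_measurable : - (2 * pi * n0%:R) <= Re (0 : R[i]).
    by rewrite oppr_le0 !mulr_ge0// pi_ge0.
  rewrite (_ : (fun t => _) = phi)//; apply/funext => t.
  by rewrite oppr0 mul0r cexp0 mul1r.
pose L n := 2 * pi * freq kappa j n : R.
pose h n t := cexp (- (L n)%:C * t%:C) * phi t.
pose g n t := a j n * h n t.
have hE n t : h n t = (expR (- L n * t))%:C * phi t.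
  by rewrite /h -cexp_real (real_complexM (- L n) t) (real_complexN (L n)).
have mh n : cmeasurable D (h n).
  rewrite (_ : h n = fun t => (expR (- L n * t))%:C * phi t); last exact/funext/hE.
  apply: cmeasurableM => //; apply: cmeasurable_real.
  by apply: measurableT_comp => //; exact: measurable_funM.
have mg n : cmeasurable D (g n) by apply: cmeasurableM => //; exact: cmeasurable_cst.
have gE n : (\int[mu]_(t in D) (normc (g n t))%:E =
    (normc (a j n))%:E * laplace_abs phi (L n))%E.
  rewrite /laplace_abs -ge0_integralZl_EFin ?normc_ge0//.
  - apply: eq_integral => t _; rewrite -EFinM /g normcM hE normcM normc_real.
    by rewrite ger0_norm// expR_ge0.
  - by move=> t _; rewrite lee_fin mulr_ge0 ?expR_ge0 ?normc_ge0.
  - apply/measurable_EFinP; apply: measurable_funM; last exact: measurable_normc.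
    by apply: measurableT_comp => //; exact: measurable_funM.
have sg : (\esum_(n in [set: int]) \int[mu]_(t in D) (normc (g n t))%:E < +oo)%E.
  by under eq_esum do rewrite gE; exact: sphi.
have ig n : cintegrable D (g n).
  apply: cintegrable_normc => //; apply: le_lt_trans sg.
  apply: esum_ge; exists [set n]; first by split => //; exact: finite_set1.
  by rewrite fsbig_set1.
have gL n : a j n * laplace phi (L n)%:C = cintegral D (g n).
  (* A zero coefficient says nothing about the Laplace integral at that frequency, but both sides
     vanish. Otherwise integrability of [h n] is recovered by dividing by [a j n]. *)
  have [a0|a0] := eqVneq (a j n) 0.
    rewrite a0 mul0r /g (_ : (fun t => _) = fun=> 0).
      by rewrite (cintegral0 (measurable_itv _)).2.
    by apply/funext => t; rewrite a0 mul0r.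
  have ih : cintegrable D (h n).
    have := cintegrableZ (a j n)^-1 (measurable_itv _) (ig n).
    by apply: eq_cintegrable => // t _; rewrite /g mulKf.
  by rewrite /laplace improper_integralE// cintegralZ.
have [_ hj] := ha j.
(* On the imaginary axis the Fourier exponential becomes the Laplace kernel, as
   [2 pi i l (i t) = - 2 pi l t]. *)
pose U (t : R) n := a j n * cexp (2 * pi%:C * 'i * (freq kappa j n)%:C * (t *i)) : R[i]^o.
have gU t n : g n t = phi t * U t n.
  rewrite /g /h /U.
  have <- : - (L n)%:C * t%:C = 2 * pi%:C * 'i * (freq kappa j n)%:C * (t *i).
    by rewrite /L; move: (freq _ _ _) => l; apply: complex_eqP => /=; ring.
  by rewrite mulrA mulrC.
pose GP t := phi t * limn (series (fun n => U t (Posz n))).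
pose GN t := phi t * limn (series (fun n => U t (Negz n))).
have cser (c : R[i]) (v : nat -> R[i]^o) : cvgn (series v) ->
    series (fun n => c * v n : R[i]^o) @ \oo --> (c * limn (series v) : R[i]^o).
  move=> cv; rewrite (_ : series _ = fun n => c *: (series v n : R[i]^o)); last first.
    by apply/funext => n; rewrite /series/= scaler_sumr.
  exact: cvgZr.
have fE t : 0 < t -> phi t * f (t *i) j 0 = GP t + GN t.
  by move=> t0; have [_ ->] := hj (t *i) t0; rewrite /zsum mulrDr.
have [||iG zG] := @cintegral_zsum g GP GN mg sg.
- move=> t t0; have [[cP _] _] := hj (t *i) t0.
  by under eq_fun do rewrite gU; exact: cser.
- move=> t t0; have [[_ cN] _] := hj (t *i) t0.
  by under eq_fun do rewrite gU; exact: cser.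
split.
- by apply: eq_cintegrable iG => // t /mem_pos t0; rewrite fE.
- rewrite mxE (_ : (fun n => _) = (fun n => cintegral D (g n))); last exact/funext/gL.
  by rewrite zG; apply: eq_cintegral => t /mem_pos t0; rewrite fE.
Qed.
End test_functions.

(** * The action of [S] on the imaginary axis *)

Lemma S_mx_entries : [/\ S_mx 0 0 = 0, S_mx 0 1 = -1, S_mx 1 0 = 1 & S_mx 1 1 = 0].
Proof. by rewrite /S_mx; split; rewrite !mxE. Qed.

Lemma S_mx_SL2Z : S_mx \in SL2Z.
Proof.
rewrite unfold_in /SL2Z (expand_det_row _ 0) !big_ord_recl big_ord0.
by rewrite /cofactor !det_mx11 !mxE /=.
Qed.

Lemma autj_S (tau : R[i]) : autj S_mx tau = tau.
Proof.
by have [s1 s2 s3 s4] := S_mx_entries; rewrite /autj s3 s4 mulr1z mul1r mulr0z addr0.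
Qed.

Lemma moebius_S (y : R) : 0 < y -> moebius S_mx (y *i) = y^-1 *i.
Proof.
move=> y0; have [s1 s2 s3 s4] := S_mx_entries.
rewrite /moebius autj_S s1 s2 mulr0z mul0r add0r.
have yi : y *i != 0 :> R[i] by apply/eqP => -[/eqP]; rewrite gt_eqF.
apply: (mulIf yi); rewrite divfK//.
by apply: complex_eqP => /=; rewrite ?mulVf ?gt_eqF//; ring.
Qed.

(** In the principal branch [Log (i y) = ln y + i pi / 2], so modulus and phase separate without
    crossing the cut. *)
Lemma cpow_imag (y k : R) : 0 < y ->
  cpow (y *i) k%:C = (y `^ k)%:C * cpow 'i k%:C.
Proof.
move=> y0.
have LogE (x : R) : 0 < x -> Log (x *i) = (ln x)%:C + (pi / 2) *i.
  move=> x0; rewrite /Log /Arg/= (ltW x0) mul0r acos0.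
  rewrite expr0n/= add0r sqrtr_sqr gtr0_norm//.
  by apply: complex_eqP; rewrite /= ?addr0 ?add0r.
rewrite /cpow (LogE y)// (LogE 1)// ln1 add0r mulrDr cexpD -real_complexM cexp_real.
by rewrite /powR gt_eqF.
Qed.

Section S_transformation.
Variables (k : R) (chi : 'M[int]_2 -> R[i]) (m : nat) (rho : 'M[int]_2 -> 'M[R[i]]_m).
Variable f : R[i] -> 'cV[R[i]]_m.
Hypothesis chi1 : `|chi S_mx| = 1.
Hypothesis rhoS : rho S_mx \in unitmx.
Hypothesis fS : forall tau, 0 < Im tau -> slash k chi rho f S_mx tau = f tau.

(** Invariance under [S] at [i y], solved for the value at [S (i y) = i / y]. *)
Lemma modular_S (y : R) : 0 < y ->
  f (y^-1 *i) = (cpow 'i k%:C * (y `^ k)%:C * chi S_mx) *: (rho S_mx *m f (y *i)).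
Proof.
move=> y0.
have chi0 : chi S_mx != 0 by rewrite -normr_eq0 chi1 oner_eq0.
rewrite -(fS (tau := y *i))// /slash autj_S moebius_S// -scalemxAr mulKVmx// scalerA.
rewrite (cpow_imag (- k) y0) powRN (real_complexN k).
rewrite (_ : cpow 'i (- k%:C) = (cpow 'i k%:C)^-1); last by rewrite /cpow mulNr cexpN.
rewrite (_ : _ * _ = 1) ?scale1r// real_complexV.
have h1 : (y `^ k)%:C != 0 by rewrite real_complex_eq0 gt_eqF// powR_gt0.
have h2 : cpow 'i k%:C != 0 by rewrite cexp_neq0.
by field; rewrite chi0 h1 h2.
Qed.
End S_transformation.
End LSeries.

(** * Dirichlet series, integral representation and functional equation *)

Theorem theorem2p1 (R : realType) (k : R) (hk : 2 * k \is a Num.int)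
  (chi : 'M[int]_2 -> R[i]) (hchi : multiplier_system k chi)
  (m : nat) (hm : (1 <= m)%N)
  (rho : 'M[int]_2 -> 'M[R[i]]_m) (hrho : unitary_representation rho)
  (kappa : 'I_m -> R) (hkappa : forall j, 0 <= kappa j < 1)
  (f : R[i] -> 'cV[R[i]]_m) (hf : weakly_holomorphic k chi rho kappa f)
  (a : 'I_m -> int -> R[i]) (ha : fourier_expansion kappa f a)
  (n0 : nat) (hn0 : growth_bound n0 f) :
  [/\ cuspidal kappa a -> forall s : R[i], 0 < Re s ->
        (forall j, zsum_abs_cvg (dirichlet_term kappa a s j)) ->
        [/\ forall j n, 0 < freq kappa j n ->
              laplace_cvg (I_test s) (2 * pi * freq kappa j n)%:C,
            forall j, zsum_cvg (L_pos_term kappa a (I_test s) j) &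
            L_pos kappa a (I_test s) = dirichlet_L kappa a s],
      forall phi : R -> R[i], test_space n0 kappa a phi ->
        vimproper_cvg (fun y : R => phi y *: f (y *i)) /\
        L_test kappa a phi = vimproper_integral (fun y : R => phi y *: f (y *i)) &
      forall phi : R -> R[i], test_space n0 kappa a phi ->
        test_space n0 kappa a (slash_S k chi phi) ->
        L_test kappa a phi =
          cpow 'i k%:C *: (rho S_mx *m L_test kappa a (slash_S k chi phi))].
Proof.
split.
- move=> _ s s0 cL.
  (* The series agree term by term: both terms are 0 at nonpositive frequencies, and the Laplace
     transform of [I_test s] is known at positive ones. *)
  have E j : L_pos_term kappa a (I_test s) j = dirichlet_term kappa a s j.
    apply/funext => n; rewrite /L_pos_term /dirichlet_term; case: ifPn => // l0.
    by rewrite (laplace_I_test s0 l0).2.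
  split=> [j n l0|j|].
  + exact: (laplace_I_test s0 l0).1.
  + by rewrite E; exact: zsum_abs_cvgP.
  + by apply/matrixP => j o; rewrite !mxE E.
- move=> phi tphi.
  have E j : (fun y : R => (phi y *: f (y *i)) j 0) = (fun y => phi y * f (y *i) j 0).
    by apply/funext => y; rewrite mxE.
  split.
  + by move=> j; rewrite E; apply: cintegrable_improper_cvg; exact: (L_testE ha j tphi).1.
  + apply/matrixP => j o; rewrite ord1 (L_testE ha j tphi).2 mxE E.
    by rewrite improper_integralE//; exact: (L_testE ha j tphi).1.
- move=> phi tphi tpsi; set psi := slash_S k chi phi in tpsi *.
  have [_ fslash _] := hf.
  have fS tau : 0 < Im tau -> slash k chi rho f S_mx tau = f tau.
    by move=> t0; apply: fslash => //; exact: S_mx_SL2Z.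
  have chi1 : `|chi S_mx| = 1 by apply: hchi.1; exact: S_mx_SL2Z.
  have rhoS : rho S_mx \in unitmx.
    by apply: unitarymx_unit; case: hrho => _ _; apply; exact: S_mx_SL2Z.
  apply/matrixP => j o; rewrite ord1 {o}.
  have [iphi ->] := L_testE ha j tphi.
  rewrite [RHS]mxE [X in _ * X]mxE.
  (* The left-hand integral is inverted so that [f (i / y)] appears and modularity applies. *)
  rewrite -(cintegral_inversion (cintegrable_measurable iphi)).
  rewrite mulr_sumr.
  (* The matrix product is a finite sum of integrals, gathered under one integral so that integrands
     can be compared pointwise. *)
  under [RHS]eq_bigr => l _.
    rewrite (L_testE ha l tpsi).2 mulrA.
    rewrite -cintegralZ//; last exact: (L_testE ha l tpsi).1.
    over.
  rewrite -cintegral_sum//; last first.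
    by move=> l; apply: cintegrableZ => //; exact: (L_testE ha l tpsi).1.
  apply: eq_cintegral => y /mem_pos y0 /=.
  rewrite (modular_S chi1 rhoS fS y0) !mxE mulr_sumr mulr_sumr mulr_suml.
  apply: eq_bigr => l _; rewrite /psi /slash_S.
  (* The Jacobian [y^-2] of the inversion and the [y^k] from modularity combine into the exponent
     [k - 2] of the slash action. *)
  have -> : (y `^ (k - 2))%:C = (y `^ k)%:C * (y^-1 * y^-1)%:C :> R[i].
    rewrite -real_complexM; congr (_%:C); rewrite /powR gt_eqF// mulrBl expRB.
    by rewrite mulrC -[2]/(1 + 1) mulrDl !mul1r expRD lnK//; field; rewrite gt_eqF// expR_gt0.
  by ring.
Qed.
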